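(* Let $\varphi$ be a linear fractional self-map of $\mathbb{D}$. The following are equivalent: (1) $\varphi$ can be embedded into a semigroup in $\mathbb{D}$ (of holomorphic self-maps). (2) $\varphi$ can be embedded into a semigroup of linear fractional self-maps of $\mathbb{D}$. (3) $\varphi$, thought of as an element of $\mathrm{Aut}(\mathbb{C}_\infty)$, can be embedded into a group $(\varphi_t)_{t\in\mathbb{R}}$ of $\mathrm{Aut}(\mathbb{C}_\infty)$ with the property that $\varphi_t(\mathbb{D})\subseteq\mathbb{D}$ for all $t\ge0$.
   Context: $\mathbb{D}$ is the open unit disc in $\mathbb{C}$, $\mathbb{C}_\infty$ is the Riemann sphere, and $\mathrm{Aut}(\mathbb{C}_\infty)$ is the group of Möbius transformations. A linear fractional self-map of $\mathbb{D}$ is a non-constant map $z\mapsto\frac{az+b}{cz+d}$, with $|d|>|c|$, mapping $\mathbb{D}$ into $\mathbb{D}$. A (continuous) semigroup in $\mathbb{D}$ is a family $(\varphi_t)_{t\ge0}$ of holomorphic maps $\varphi_t:\mathbb{D}\to\mathbb{D}$ with $\varphi_0=\mathrm{id}$, $\varphi_{t+s}=\varphi_t\circ\varphi_s$, and $\varphi_t\to\mathrm{id}$ uniformly on compacta as $t\to0^+$; it is a semigroup of linear fractional self-maps if every $\varphi_t$ is one. A group $(\varphi_t)_{t\in\mathbb{R}}$ of $\mathrm{Aut}(\mathbb{C}_\infty)$ is a continuous homomorphism $t\mapsto\varphi_t$ from $(\mathbb{R},+)$ to $\mathrm{Aut}(\mathbb{C}_\infty)$. ''$\varphi$ can be embedded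 into $(\varphi_t)$'' means $\varphi_1=\varphi$. *)

(* Defs.v *)
From Stdlib Require Import Reals List.
From Coquelicot Require Import Coquelicot.

Open Scope R_scope.

Definition unit_disc (z : C) : Prop := Cmod z < 1.

Definition self_map_disc (f : C -> C) : Prop :=
  forall z : C, unit_disc z -> unit_disc (f z).

(* A map of the disc is represented by a total function [C -> C] of which only
   the values on [unit_disc] matter. *)
Definition eq_on_disc (f g : C -> C) : Prop :=
  forall z : C, unit_disc z -> f z = g z.

Definition nonconstant_on_disc (f : C -> C) : Prop :=
  exists z w : C, unit_disc z /\ unit_disc w /\ f z <> f w.

(* Complex differentiability: the scalars are [C], not [R]. *)
Definition holomorphic_on_disc (f : C -> C) : Prop :=
  forall z : C, unit_disc z -> @ex_derive C_AbsRing C_NormedModule f z.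

Definition lf_self_map_coeffs (a b c d : C) (f : C -> C) : Prop :=
  Cmod c < Cmod d /\
  eq_on_disc f (fun z : C => ((a * z + b) / (c * z + d))%C) /\
  self_map_disc f /\
  nonconstant_on_disc f.

Definition lf_self_map (f : C -> C) : Prop :=
  exists a b c d : C, lf_self_map_coeffs a b c d f.

Definition compact_set {T : UniformSpace} (K : T -> Prop) : Prop :=
  forall (I : Type) (U : I -> T -> Prop),
    (forall i : I, open (U i)) ->
    (forall x : T, K x -> exists i : I, U i x) ->
    exists l : list I, forall x : T, K x -> exists i : I, In i l /\ U i x.

(* Only the values [phi t] with [0 <= t] matter. *)
Definition semigroup_in_disc (phi : R -> C -> C) : Prop :=
  (forall t : R, 0 <= t -> self_map_disc (phi t) /\ holomorphic_on_disc (phi t)) /\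
  eq_on_disc (phi 0) (fun z : C => z) /\
  (forall t s : R, 0 <= t -> 0 <= s ->
     eq_on_disc (phi (t + s)) (fun z : C => phi t (phi s z))) /\
  (forall K : C -> Prop,
     @compact_set C_UniformSpace K ->
     (forall z : C, K z -> unit_disc z) ->
     forall eps : posreal,
       at_right 0 (fun t : R => forall z : C, K z -> Cmod (phi t z - z) < eps)).

Definition lf_semigroup_in_disc (phi : R -> C -> C) : Prop :=
  semigroup_in_disc phi /\ forall t : R, 0 <= t -> lf_self_map (phi t).

Inductive sphere : Type :=
  | Fin (z : C)
  | Inf.

Definition mobius (a b c d : C) (p : sphere) : sphere :=
  match p with
  | Fin z =>
      if Ceq_dec (c * z + d)%C (RtoC 0) then Inf
      else Fin ((a * z + b) / (c * z + d))%C
  | Inf => if Ceq_dec c (RtoC 0) then Inf else Fin (a / c)%C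
  end.

Definition is_mobius (F : sphere -> sphere) : Prop :=
  exists a b c d : C,
    (a * d - b * c)%C <> RtoC 0 /\ forall p : sphere, F p = mobius a b c d p.

(* Euclidean distance in R^3 of the stereographic preimages on the unit sphere. *)
Definition chordal_dist (p q : sphere) : R :=
  match p, q with
  | Fin z, Fin w =>
      2 * Cmod (z - w) / (sqrt (1 + Cmod z ^ 2) * sqrt (1 + Cmod w ^ 2))
  | Fin z, Inf | Inf, Fin z => 2 / sqrt (1 + Cmod z ^ 2)
  | Inf, Inf => 0
  end.

(* The last clause is continuity of [t |-> Phi t] for the usual topology of the
   Moebius group, that of uniform convergence on the sphere. *)
Definition mobius_group (Phi : R -> sphere -> sphere) : Prop :=
  (forall t : R, is_mobius (Phi t)) /\
  (forall (t s : R) (p : sphere), Phi (t + s) p = Phi t (Phi s p)) /\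
  (forall (t0 : R) (eps : posreal),
     locally t0
       (fun t : R => forall p : sphere, chordal_dist (Phi t p) (Phi t0 p) < eps)).

Definition maps_disc_into_disc (F : sphere -> sphere) : Prop :=
  forall z : C, unit_disc z -> exists w : C, unit_disc w /\ F (Fin z) = Fin w.

(* Main.v *)
Require Import Defs.
From Stdlib Require Import Reals List Lra Psatz.
From Coquelicot Require Import Coquelicot.

Open Scope R_scope.

(** A group of Moebius transformations that maps the disc into itself for
    t >= 0 restricts to a semigroup of linear fractional self-maps, which is in
    particular a semigroup of holomorphic ones ([mobius_group_restricts]).  What
    has to be shown is that a map f which embeds into a semigroup of holomorphic
    self-maps embeds into such a group ([semigroup_embeds_in_mobius_group]).

    The map f has a fixed point z in the closed disc ([fixed_point_in_closed_disc]),
    and its position decides.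

    - If |z| = 1, send z to infinity and the disc to the right half-plane.  Then f
      becomes w |-> al w + be, and invariance of the half-plane forces al > 0 and
      Re be >= 0.  The affine flow through this map preserves the half-plane, so f
      always embeds ([boundary_fixed_point_embeds]).

    - If |z| < 1 and the reflected point 1 / conj z is fixed too, a disc
      automorphism turns f into multiplication by some l with |l| <= 1, and f
      again always embeds, into l^t ([symmetric_fixed_points_embed]).

    - Otherwise |z| < 1 and the multiplier l of f at z satisfies |l| < 1.  A Moebius
      coordinate sigma, holomorphic on the disc with sigma z = 0, satisfies
      sigma o f = l sigma.  Not every such f embeds, so the given semigroup psi must
      supply the group.  Its members commute with f and fix z; comparing them
      with their derivative at z along an orbit of f gives sigma o psi_t = mu_t sigma
      ([commuting_map_is_linear]).  The numbers mu_t extend to a one-parameter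
      group of multipliers, and the group mu_t, read in the coordinate sigma, is the
      desired one ([attracting_semigroup_embeds]).

    In all three cases the group is a conjugate of a one-parameter group of affine
    maps; its continuity is that of the matrix entries ([affine_conj_group]). *)

(** * Complex numbers *)

Lemma Cmod_lt_sqr (z w : C) : Cmod z ^ 2 < Cmod w ^ 2 -> Cmod z < Cmod w.
Proof.
  intros H. pose proof (Cmod_ge_0 z). pose proof (Cmod_ge_0 w). nra.
Qed.

Lemma Cmod_le_sqr (z w : C) : Cmod z ^ 2 <= Cmod w ^ 2 -> Cmod z <= Cmod w.
Proof.
  intros H. pose proof (Cmod_ge_0 z). pose proof (Cmod_ge_0 w). nra.
Qed.

Lemma Cmod_minus_ge (z w : C) : Cmod z - Cmod w <= Cmod (z - w).
Proof.
  pose proof (Cmod_triangle (z - w) w) as H.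
  replace (z - w + w)%C with z in H by ring. lra.
Qed.

Lemma Cmod_minus_triangle (z w : C) : Cmod (z - w) <= Cmod z + Cmod w.
Proof.
  rewrite <- (Cmod_opp w). apply (Cmod_triangle z (- w)).
Qed.

Lemma Cmod_plus_ge (z w : C) : Cmod z - Cmod w <= Cmod (z + w).
Proof.
  pose proof (Cmod_minus_ge z (- w)) as H.
  rewrite Cmod_opp in H. replace (z - - w)%C with (z + w)%C in H by ring. exact H.
Qed.

Lemma Cdiv_neq_0 (z w : C) : z <> 0 -> w <> 0 -> (z / w)%C <> 0.
Proof.
  intros Hz Hw E. apply Hz.
  replace z with (z / w * w)%C by (field; exact Hw). rewrite E. ring.
Qed.

Lemma Cmult_integral (z w : C) : (z * w)%C = 0 -> z = 0 \/ w = 0.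
Proof.
  intros E. destruct (Ceq_dec z 0) as [|Hz]; [now left|right].
  replace w with (/ z * (z * w))%C by (field; exact Hz). rewrite E. ring.
Qed.

(** * Moebius maps in homogeneous coordinates *)

(** The point of the sphere with homogeneous coordinates [x : y].  In these
    coordinates Moebius maps are linear and infinity is an ordinary point. *)
Definition ratio (x y : C) : sphere :=
  if Ceq_dec y 0 then Inf else Fin (x / y)%C.

Lemma ratio_surj (p : sphere) : exists x y : C, (x <> 0 \/ y <> 0) /\ p = ratio x y.
Proof.
  destruct p as [z|].
  - exists z, (RtoC 1). split; [right; exact C1_nz|].
    unfold ratio. destruct (Ceq_dec 1 0) as [E|_]; [now destruct (C1_nz E)|].
    f_equal. field.
  - exists (RtoC 1), (RtoC 0). split; [left; exact C1_nz|].
    unfold ratio. destruct (Ceq_dec 0 0) as [_|n]; [reflexivity|now destruct n].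
Qed.

Lemma ratio_scale (k x y : C) : k <> 0 -> ratio (k * x) (k * y) = ratio x y.
Proof.
  intros Hk. unfold ratio.
  destruct (Ceq_dec y 0) as [->|Hy].
  - destruct (Ceq_dec (k * 0) 0) as [_|n]; [reflexivity|destruct n; ring].
  - destruct (Ceq_dec (k * y) 0) as [E|n].
    + destruct (Cmult_integral _ _ E); contradiction.
    + f_equal. field. now split.
Qed.

Lemma mobius_ratio (a b c d x y : C) :
  x <> 0 \/ y <> 0 ->
  mobius a b c d (ratio x y) = ratio (a * x + b * y) (c * x + d * y).
Proof.
  intros Hxy. unfold ratio at 1. destruct (Ceq_dec y 0) as [Hy|Hy].
  - assert (Hx : x <> 0) by tauto.
    subst y. simpl.
    replace (a * x + b * 0)%C with (x * a)%C by ring.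
    replace (c * x + d * 0)%C with (x * c)%C by ring.
    rewrite ratio_scale by exact Hx. reflexivity.
  - simpl. rewrite <- (ratio_scale (/ y) (a * x + b * y)).
    2:{ intros E. apply Hy. replace y with (y * (y * / y))%C by (field; exact Hy).
        rewrite E. ring. }
    replace (/ y * (a * x + b * y))%C with (a * (x / y) + b)%C by (field; exact Hy).
    replace (/ y * (c * x + d * y))%C with (c * (x / y) + d)%C by (field; exact Hy).
    reflexivity.
Qed.

Lemma mobius_ratio_nz (a b c d x y : C) :
  (a * d - b * c)%C <> 0 -> x <> 0 \/ y <> 0 ->
  (a * x + b * y)%C <> 0 \/ (c * x + d * y)%C <> 0.
Proof.
  intros Hdet Hxy.
  destruct (Ceq_dec (a * x + b * y) 0) as [E1|]; [|now left].
  destruct (Ceq_dec (c * x + d * y) 0) as [E2|]; [|now right].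
  exfalso.
  assert (Ex : ((a * d - b * c) * x)%C = 0).
  { replace ((a * d - b * c) * x)%C
      with (d * (a * x + b * y) - b * (c * x + d * y))%C by ring.
    rewrite E1, E2. ring. }
  assert (Ey : ((a * d - b * c) * y)%C = 0).
  { replace ((a * d - b * c) * y)%C
      with (a * (c * x + d * y) - c * (a * x + b * y))%C by ring.
    rewrite E1, E2. ring. }
  destruct (Cmult_integral _ _ Ex), (Cmult_integral _ _ Ey); tauto.
Qed.

Lemma mobius_comp (a b c d a' b' c' d' : C) (p : sphere) :
  (a' * d' - b' * c')%C <> 0 ->
  mobius a b c d (mobius a' b' c' d' p)
  = mobius (a * a' + b * c') (a * b' + b * d') (c * a' + d * c') (c * b' + d * d') p.
Proof.
  intros Hdet. destruct (ratio_surj p) as (x & y & Hxy & ->).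
  rewrite (mobius_ratio a') by exact Hxy.
  rewrite mobius_ratio by (apply mobius_ratio_nz; assumption).
  rewrite mobius_ratio by exact Hxy.
  f_equal; ring.
Qed.

Lemma mobius_scale (k a b c d : C) (p : sphere) :
  k <> 0 -> mobius (k * a) (k * b) (k * c) (k * d) p = mobius a b c d p.
Proof.
  intros Hk. destruct (ratio_surj p) as (x & y & Hxy & ->).
  rewrite !mobius_ratio by exact Hxy. rewrite <- (ratio_scale k (a * x + b * y)) by exact Hk.
  f_equal; ring.
Qed.

Lemma mobius_adjugate (a b c d : C) (p : sphere) :
  (a * d - b * c)%C <> 0 -> mobius d (- b) (- c) a (mobius a b c d p) = p.
Proof.
  intros Hdet. rewrite mobius_comp by exact Hdet.
  destruct (ratio_surj p) as (x & y & Hxy & ->).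
  rewrite mobius_ratio by exact Hxy.
  rewrite <- (ratio_scale (a * d - b * c) x y) by exact Hdet.
  f_equal; ring.
Qed.

Lemma mobius_Fin (a b c d z : C) :
  (c * z + d)%C <> 0 -> mobius a b c d (Fin z) = Fin ((a * z + b) / (c * z + d))%C.
Proof.
  intros H. simpl. destruct (Ceq_dec (c * z + d) 0); [contradiction|reflexivity].
Qed.

(** * Continuity in the chordal metric *)

Definition hnorm (x y : C) : R := sqrt (Cmod x ^ 2 + Cmod y ^ 2).

Lemma hnorm_ge_l (x y : C) : Cmod x <= hnorm x y.
Proof.
  unfold hnorm. rewrite <- (sqrt_pow2 (Cmod x)) at 1 by apply Cmod_ge_0.
  apply sqrt_le_1_alt. pose proof (pow2_ge_0 (Cmod y)). lra.
Qed.

Lemma hnorm_ge_r (x y : C) : Cmod y <= hnorm x y.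
Proof.
  unfold hnorm. rewrite <- (sqrt_pow2 (Cmod y)) at 1 by apply Cmod_ge_0.
  apply sqrt_le_1_alt. pose proof (pow2_ge_0 (Cmod x)). lra.
Qed.

Lemma hnorm_pos (x y : C) : x <> 0 \/ y <> 0 -> 0 < hnorm x y.
Proof.
  pose proof (hnorm_ge_l x y). pose proof (hnorm_ge_r x y).
  intros [Hx|Hx]; apply Cmod_gt_0 in Hx; lra.
Qed.

Lemma hnorm_normalize (x y : C) :
  y <> 0 -> sqrt (1 + Cmod (x / y) ^ 2) = hnorm x y / Cmod y.
Proof.
  intros Hy. assert (Hy' := proj1 (Cmod_gt_0 y) Hy).
  unfold hnorm. rewrite Cmod_div by exact Hy.
  replace (1 + (Cmod x / Cmod y) ^ 2)
    with ((Cmod x ^ 2 + Cmod y ^ 2) / Cmod y ^ 2) by (field; lra).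
  rewrite sqrt_div_alt by (apply pow_lt; lra).
  rewrite sqrt_pow2 by lra. reflexivity.
Qed.

(** The homogeneous formula has no exceptional case at infinity, which makes
    the estimates below uniform over the sphere. *)
Lemma chordal_dist_ratio (x y x' y' : C) :
  x <> 0 \/ y <> 0 -> x' <> 0 \/ y' <> 0 ->
  chordal_dist (ratio x y) (ratio x' y')
  = 2 * Cmod (x * y' - x' * y) / (hnorm x y * hnorm x' y').
Proof.
  intros H H'. pose proof (hnorm_pos _ _ H) as Hn. pose proof (hnorm_pos _ _ H') as Hn'.
  unfold ratio.
  destruct (Ceq_dec y 0) as [E|E], (Ceq_dec y' 0) as [E'|E']; simpl chordal_dist.
  - subst. replace (x * 0 - x' * 0)%C with (RtoC 0) by ring.
    rewrite Cmod_0. field. lra.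
  - subst. assert (Hy' := proj1 (Cmod_gt_0 y') E').
    replace (x * y' - x' * 0)%C with (x * y')%C by ring.
    rewrite Cmod_mult. fold (Cmod (x' / y')). 
    change (Cmod (x' / y') * (Cmod (x' / y') * 1)) with (Cmod (x' / y') ^ 2).
    rewrite hnorm_normalize by exact E'.
    assert (Hx : x <> 0) by tauto. apply Cmod_gt_0 in Hx.
    replace (hnorm x 0) with (Cmod x).
    + field. repeat split; lra.
    + unfold hnorm. rewrite Cmod_0. replace (Cmod x ^ 2 + 0 ^ 2) with (Cmod x ^ 2) by ring.
      rewrite sqrt_pow2; lra.
  - subst. assert (Hy := proj1 (Cmod_gt_0 y) E).
    replace (x * 0 - x' * y)%C with (- (x' * y))%C by ring.
    rewrite Cmod_opp, Cmod_mult.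
    change (Cmod (x / y) * (Cmod (x / y) * 1)) with (Cmod (x / y) ^ 2).
    rewrite hnorm_normalize by exact E.
    assert (Hx' : x' <> 0) by tauto. apply Cmod_gt_0 in Hx'.
    replace (hnorm x' 0) with (Cmod x').
    + field. repeat split; lra.
    + unfold hnorm. rewrite Cmod_0. replace (Cmod x' ^ 2 + 0 ^ 2) with (Cmod x' ^ 2) by ring.
      rewrite sqrt_pow2; lra.
  - assert (Hy := proj1 (Cmod_gt_0 y) E). assert (Hy' := proj1 (Cmod_gt_0 y') E').
    change (Cmod (x / y) * (Cmod (x / y) * 1)) with (Cmod (x / y) ^ 2).
    change (Cmod (x' / y') * (Cmod (x' / y') * 1)) with (Cmod (x' / y') ^ 2).
    rewrite !hnorm_normalize by assumption.
    replace (x / y - x' / y')%C with ((x * y' - x' * y) / (y * y'))%C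
      by (field; now split).
    assert (Hyy : (y * y')%C <> 0) by (apply Cmod_gt_0; rewrite Cmod_mult; nra).
    rewrite Cmod_div, Cmod_mult by exact Hyy.
    field. repeat split; lra.
Qed.

(** For u = M' p and v = M p the chordal distance is 2 |u /\ v| / (|u| |v|) with
    u /\ v = (u - v) /\ u up to sign, hence at most a multiple of |u - v| / |v|;
    and |v| is bounded below by a multiple of |p| since M is invertible. *)
Lemma mobius_chordal_continuous (a b c d : C) (eps : posreal) :
  (a * d - b * c)%C <> 0 ->
  exists delta : posreal, forall a' b' c' d' : C,
    (a' * d' - b' * c')%C <> 0 ->
    Cmod (a' - a) < delta -> Cmod (b' - b) < delta ->
    Cmod (c' - c) < delta -> Cmod (d' - d) < delta ->
    forall p : sphere, chordal_dist (mobius a' b' c' d' p) (mobius a b c d p) < eps.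
Proof.
  intros Hdet.
  assert (Hdet' := proj1 (Cmod_gt_0 _) Hdet).
  set (D := Cmod (a * d - b * c)) in *.
  set (S := Cmod a + Cmod b + Cmod c + Cmod d + 1).
  pose proof (Cmod_ge_0 a) as Ha. pose proof (Cmod_ge_0 b) as Hb.
  pose proof (Cmod_ge_0 c) as Hc. pose proof (Cmod_ge_0 d) as Hd.
  destruct eps as [eps Heps]. simpl.
  (* |p| <= 2 S |v| / D and |u - v| <= delta |p| below make the distance at most
     8 delta S / D, that is eps / 4 *)
  set (delta := eps * D / (32 * S)).
  assert (HS : 0 < S) by (unfold S; lra).
  assert (Hdelta : 0 < delta) by (unfold delta; apply Rdiv_lt_0_compat; nra).
  exists (mkposreal _ Hdelta). intros a' b' c' d' Hdeta Da Db Dc Dd p; simpl in *.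
  destruct (ratio_surj p) as (x & y & Hxy & ->).
  rewrite !mobius_ratio by exact Hxy.
  rewrite chordal_dist_ratio by (apply mobius_ratio_nz; assumption).
  pose proof (hnorm_pos _ _ (mobius_ratio_nz _ _ _ _ _ _ Hdet Hxy)) as Hv.
  pose proof (hnorm_pos _ _ (mobius_ratio_nz _ _ _ _ _ _ Hdeta Hxy)) as Hu.
  set (u1 := (a' * x + b' * y)%C) in *. set (u2 := (c' * x + d' * y)%C) in *.
  set (v1 := (a * x + b * y)%C) in *. set (v2 := (c * x + d * y)%C) in *.
  set (U := hnorm u1 u2) in *. set (V := hnorm v1 v2) in *.
  set (X := Cmod x + Cmod y).
  pose proof (Cmod_ge_0 x) as Hx. pose proof (Cmod_ge_0 y) as Hy.
  pose proof (hnorm_ge_l u1 u2) as U1. pose proof (hnorm_ge_r u1 u2) as U2. fold U in U1, U2.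
  pose proof (hnorm_ge_l v1 v2) as V1. pose proof (hnorm_ge_r v1 v2) as V2. fold V in V1, V2.
  (* Cramer's rule bounds the argument by its image *)
  assert (Bx : D * Cmod x <= S * V).
  { unfold D. rewrite <- Cmod_mult.
    replace ((a * d - b * c) * x)%C with (d * v1 - b * v2)%C by (unfold v1, v2; ring).
    eapply Rle_trans; [apply Cmod_minus_triangle|]. rewrite !Cmod_mult. unfold S. nra. }
  assert (By : D * Cmod y <= S * V).
  { unfold D. rewrite <- Cmod_mult.
    replace ((a * d - b * c) * y)%C with (a * v2 - c * v1)%C by (unfold v1, v2; ring).
    eapply Rle_trans; [apply Cmod_minus_triangle|]. rewrite !Cmod_mult. unfold S. nra. }
  assert (BX : D * X <= 2 * (S * V)) by (unfold X; lra).
  assert (B1 : Cmod (u1 - v1) <= delta * X).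
  { replace (u1 - v1)%C with ((a' - a) * x + (b' - b) * y)%C by (unfold u1, v1; ring).
    eapply Rle_trans; [apply Cmod_triangle|]. rewrite !Cmod_mult. unfold X. nra. }
  assert (B2 : Cmod (u2 - v2) <= delta * X).
  { replace (u2 - v2)%C with ((c' - c) * x + (d' - d) * y)%C by (unfold u2, v2; ring).
    eapply Rle_trans; [apply Cmod_triangle|]. rewrite !Cmod_mult. unfold X. nra. }
  assert (HX : 0 <= X) by (unfold X; lra).
  assert (BW : Cmod (u1 * v2 - v1 * u2) <= U * (2 * (delta * X))).
  { replace (u1 * v2 - v1 * u2)%C with ((u1 - v1) * u2 - u1 * (u2 - v2))%C by ring.
    eapply Rle_trans; [apply Cmod_minus_triangle|]. rewrite !Cmod_mult.
    pose proof (Cmod_ge_0 u1). pose proof (Cmod_ge_0 u2).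
    pose proof (Cmod_ge_0 (u1 - v1)). pose proof (Cmod_ge_0 (u2 - v2)). nra. }
  assert (BD : delta * X <= eps / 16 * V).
  { replace (delta * X) with (eps / (32 * S) * (D * X)) by (unfold delta; field; lra).
    replace (eps / 16 * V) with (eps / (32 * S) * (2 * (S * V))) by (field; lra).
    apply Rmult_le_compat_l; [|exact BX]. left. apply Rdiv_lt_0_compat; lra. }
  apply Rle_lt_trans with (eps / 4); [|lra].
  apply Rle_div_l; [nra|]. nra.
Qed.

(** * Conjugates of one-parameter affine groups *)

(** The affine map w |-> m w + n in the coordinate w = (p z + q) / (r z + s).
    All groups built below have this form. *)
Definition affine_conj (p q r s : C) (m n : R -> C) (t : R) (z : sphere) : sphere :=
  mobius s (- q) (- r) p (mobius (m t) (n t) 0 1 (mobius p q r s z)).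

Lemma affine_conj_matrix (p q r s : C) (m n : R -> C) (t : R) (z : sphere) :
  (p * s - q * r)%C <> 0 -> m t <> 0 ->
  affine_conj p q r s m n t z
  = mobius (s * (m t * p + n t * r) - q * r) (s * (m t * q + n t * s) - q * s)
           (p * r - r * (m t * p + n t * r)) (p * s - r * (m t * q + n t * s)) z.
Proof.
  intros Hdet Hm. unfold affine_conj.
  rewrite (mobius_comp _ _ _ _ _ _ _ _ (mobius p q r s z)), mobius_comp.
  - f_equal; ring.
  - exact Hdet.
  - intros E. apply Hm. rewrite <- E. ring.
Qed.

Lemma affine_conj_det (p q r s m n : C) :
  (p * s - q * r)%C <> 0 -> m <> 0 ->
  ((s * (m * p + n * r) - q * r) * (p * s - r * (m * q + n * s))
   - (s * (m * q + n * s) - q * s) * (p * r - r * (m * p + n * r)))%C <> 0.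
Proof.
  intros Hdet Hm E.
  destruct (Cmult_integral m ((p * s - q * r) * (p * s - q * r))) as [E'|E'].
  - rewrite <- E. ring.
  - contradiction.
  - destruct (Cmult_integral _ _ E'); contradiction.
Qed.

Lemma affine_mobius_comp (m n m' n' : C) (z : sphere) :
  m' <> 0 -> mobius m n 0 1 (mobius m' n' 0 1 z) = mobius (m * m') (m * n' + n) 0 1 z.
Proof.
  intros Hm. rewrite mobius_comp.
  - f_equal; ring.
  - intros E. apply Hm. rewrite <- E. ring.
Qed.

(** Continuity at the parameter 0 is enough because of the functional equations:
    m t - m t0 = m t0 (m (t - t0) - 1) and n t - n t0 = m t0 n (t - t0). *)
Lemma affine_conj_group (p q r s : C) (m n : R -> C) :
  (p * s - q * r)%C <> 0 ->
  (forall t, m t <> 0) ->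
  (forall t u, m (t + u) = (m t * m u)%C) ->
  (forall t u, n (t + u) = (m t * n u + n t)%C) ->
  (forall eps : posreal, locally 0 (fun h => Cmod (m h - 1) < eps)) ->
  (forall eps : posreal, locally 0 (fun h => Cmod (n h) < eps)) ->
  mobius_group (affine_conj p q r s m n).
Proof.
  intros Hdet Hm Hmm Hmn Cm Cn. split; [|split].
  - intros t. eexists _, _, _, _. split.
    + apply (affine_conj_det p q r s (m t) (n t)); auto.
    + intros z. apply affine_conj_matrix; auto.
  - intros t u z. unfold affine_conj.
    assert (Hadj : forall z', mobius p q r s (mobius s (- q) (- r) p z') = z').
    { intros z'. pose proof (mobius_adjugate s (- q) (- r) p z') as H.
      replace (- - q)%C with q in H by ring. replace (- - r)%C with r in H by ring.
      apply H. intros E. apply Hdet. rewrite <- E. ring. }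
    rewrite Hadj, affine_mobius_comp, Hmm, Hmn by auto. reflexivity.
  - intros t0 eps.
    destruct (mobius_chordal_continuous _ _ _ _ eps
                (affine_conj_det p q r s (m t0) (n t0) Hdet (Hm t0))) as [delta Hd].
    set (S := (Cmod p + Cmod q + Cmod r + Cmod s + 1)).
    pose proof (Cmod_ge_0 p). pose proof (Cmod_ge_0 q).
    pose proof (Cmod_ge_0 r). pose proof (Cmod_ge_0 s).
    assert (HS : 0 < S) by (unfold S; lra).
    assert (Hm0 := proj1 (Cmod_gt_0 _) (Hm t0)).
    assert (Heta : 0 < delta / (2 * (S * S) * Cmod (m t0))).
    { destruct delta as [delta Hdelta]; simpl.
      apply Rdiv_lt_0_compat; [exact Hdelta|]. apply Rmult_lt_0_compat; nra. }
    set (eta := mkposreal _ Heta).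
    assert (Hloc : locally t0 (fun t => Cmod (m (t - t0) - 1) < eta
                                        /\ Cmod (n (t - t0)) < eta)).
    { destruct (Cm eta) as [e1 He1]. destruct (Cn eta) as [e2 He2].
      assert (He : 0 < Rmin e1 e2) by (apply Rmin_pos; [apply e1|apply e2]).
      exists (mkposreal _ He). intros t Ht.
      assert (Ht' : Rabs (t - t0) < Rmin e1 e2) by exact Ht.
      pose proof (Rmin_l e1 e2). pose proof (Rmin_r e1 e2).
      split.
      - apply He1. change (Rabs (t - t0 - 0) < e1). rewrite Rminus_0_r. lra.
      - apply He2. change (Rabs (t - t0 - 0) < e2). rewrite Rminus_0_r. lra. }
    apply filter_imp with (2 := Hloc). intros t [Hmt Hnt] z. change R in t.
    rewrite !affine_conj_matrix by auto.
    assert (E1 : (m t - m t0)%C = (m t0 * (m (t - t0)%R - 1))%C).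
    { replace (m t) with (m t0 * m (t - t0)%R)%C; [ring|].
      rewrite <- Hmm. f_equal. ring. }
    assert (E2 : (n t - n t0)%C = (m t0 * n (t - t0)%R)%C).
    { replace (n t) with (m t0 * n (t - t0)%R + n t0)%C; [ring|].
      rewrite <- Hmn. f_equal. ring. }
    assert (B1 : Cmod (m t - m t0) < delta / (2 * (S * S))).
    { rewrite E1, Cmod_mult.
      replace (delta / (2 * (S * S))) with (Cmod (m t0) * eta) by (simpl; field; lra).
      apply Rmult_lt_compat_l; assumption. }
    assert (B2 : Cmod (n t - n t0) < delta / (2 * (S * S))).
    { rewrite E2, Cmod_mult.
      replace (delta / (2 * (S * S))) with (Cmod (m t0) * eta) by (simpl; field; lra).
      apply Rmult_lt_compat_l; assumption. }
    (* every matrix entry is affine in (m t, n t), with coefficients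
       products of two of p, q, r, s *)
    assert (Hentry : forall k1 k2 k3 k4 x, Cmod k1 <= S -> Cmod k2 <= S -> Cmod k3 <= S ->
              Cmod k4 <= S -> x = (k1 * k2 * (m t - m t0) + k3 * k4 * (n t - n t0))%C ->
              Cmod x < delta).
    { intros k1 k2 k3 k4 x K1 K2 K3 K4 ->.
      eapply Rle_lt_trans; [apply Cmod_triangle|]. rewrite !Cmod_mult.
      pose proof (Cmod_ge_0 k1). pose proof (Cmod_ge_0 k2).
      pose proof (Cmod_ge_0 k3). pose proof (Cmod_ge_0 k4).
      pose proof (Cmod_ge_0 (m t - m t0)). pose proof (Cmod_ge_0 (n t - n t0)).
      assert (Cmod k1 * Cmod k2 <= S * S) by nra.
      assert (Cmod k3 * Cmod k4 <= S * S) by nra.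
      assert (HS2 : 0 < S * S) by nra.
      replace (pos delta) with (S * S * (delta / (2 * (S * S)))
                                + S * S * (delta / (2 * (S * S)))) by (field; lra).
      apply Rplus_lt_compat.
      - apply Rle_lt_trans with (S * S * Cmod (m t - m t0)).
        + apply Rmult_le_compat_r; assumption.
        + apply Rmult_lt_compat_l; assumption.
      - apply Rle_lt_trans with (S * S * Cmod (n t - n t0)).
        + apply Rmult_le_compat_r; assumption.
        + apply Rmult_lt_compat_l; assumption. }
    apply Hd; [apply affine_conj_det; auto| | | |].
    + apply (Hentry s p s r); try (unfold S; lra). ring.
    + apply (Hentry s q s s); try (unfold S; lra). ring.
    + apply (Hentry (- r)%C p (- r)%C r); try (rewrite ?Cmod_opp; unfold S; lra). ring.
    + apply (Hentry (- r)%C q (- r)%C s); try (rewrite ?Cmod_opp; unfold S; lra). ring.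
Qed.

(** * From Moebius groups to semigroups in the disc *)

Lemma disc_denominator_neq_0 (c d z : C) :
  Cmod c < Cmod d -> Cmod z <= 1 -> (c * z + d)%C <> 0.
Proof.
  intros Hcd Hz E.
  assert (Ed : d = (- (c * z))%C).
  { replace d with (c * z + d - c * z)%C by ring. rewrite E. ring. }
  apply (f_equal Cmod) in Ed. rewrite Cmod_opp, Cmod_mult in Ed.
  pose proof (Cmod_ge_0 c). nra.
Qed.

Lemma unit_disc_div (x y : C) : y <> 0 -> unit_disc (x / y)%C <-> Cmod x < Cmod y.
Proof.
  intros Hy. unfold unit_disc. rewrite Cmod_div by exact Hy.
  apply Cmod_gt_0 in Hy. split; intros H.
  - apply Rlt_div_l in H; lra.
  - apply Rlt_div_l; lra.
Qed.

Lemma lf_coeffs_det (a b c d : C) (f : C -> C) :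
  lf_self_map_coeffs a b c d f -> (a * d - b * c)%C <> 0.
Proof.
  intros (Hcd & Hf & _ & z & w & Hz & Hw & Hne) E. apply Hne.
  unfold unit_disc in Hz, Hw.
  assert (Nz := disc_denominator_neq_0 c d z Hcd (Rlt_le _ _ Hz)).
  assert (Nw := disc_denominator_neq_0 c d w Hcd (Rlt_le _ _ Hw)).
  rewrite (Hf z Hz), (Hf w Hw).
  replace ((a * z + b) / (c * z + d))%C
    with ((a * w + b) / (c * w + d)
          + (a * d - b * c) * (z - w) / ((c * z + d) * (c * w + d)))%C
    by (field; now split).
  rewrite E. field. now split.
Qed.

Lemma lf_coeffs_bound (a b c d : C) (f : C -> C) (z : C) :
  lf_self_map_coeffs a b c d f -> unit_disc z -> Cmod (a * z + b) < Cmod (c * z + d).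
Proof.
  intros (Hcd & Hf & Hs & _) Hz.
  apply unit_disc_div.
  - apply disc_denominator_neq_0; [exact Hcd|]. unfold unit_disc in Hz. lra.
  - rewrite <- (Hf z Hz). now apply Hs.
Qed.

Lemma mobius_disc_pole_free (a b c d : C) :
  (a * d - b * c)%C <> 0 -> maps_disc_into_disc (mobius a b c d) ->
  forall z, unit_disc z ->
    (c * z + d)%C <> 0 /\ Cmod (a * z + b) < Cmod (c * z + d).
Proof.
  intros Hdet H z Hz. destruct (H z Hz) as (w & Hw & E). simpl in E.
  destruct (Ceq_dec (c * z + d) 0) as [|Hn]; [discriminate|].
  split; [exact Hn|]. apply unit_disc_div; [exact Hn|].
  injection E as ->. exact Hw.
Qed.

(** A pole on the unit circle would have to be cancelled by a zero of the
    numerator, since |a z + b| < |c z + d| passes to the limit. *)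
Lemma mobius_disc_coeffs (a b c d : C) :
  (a * d - b * c)%C <> 0 -> maps_disc_into_disc (mobius a b c d) ->
  Cmod c < Cmod d.
Proof.
  intros Hdet H. pose proof (mobius_disc_pole_free _ _ _ _ Hdet H) as Hp.
  destruct (Rlt_le_dec (Cmod c) (Cmod d)) as [|Hle]; [assumption|exfalso].
  pose proof (Cmod_ge_0 d) as Hd.
  assert (Hd0 : d <> 0).
  { destruct (Hp (RtoC 0)) as [Hn _].
    - unfold unit_disc. rewrite Cmod_0. lra.
    - intros ->. apply Hn. ring. }
  assert (Hd' := proj1 (Cmod_gt_0 _) Hd0).
  assert (Hc0 : c <> 0) by (apply Cmod_gt_0; lra).
  assert (Hc' := proj1 (Cmod_gt_0 _) Hc0).
  set (w := (- d / c)%C).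
  assert (Hw : Cmod w <= 1).
  { unfold w. rewrite Cmod_div, Cmod_opp by exact Hc0. apply Rle_div_l; lra. }
  set (g := Cmod (a * w + b)).
  assert (Hg : 0 < g).
  { unfold g. apply Cmod_gt_0. intros E. apply Hdet.
    replace (a * d - b * c)%C with (- c * (a * w + b))%C by (unfold w; field; exact Hc0).
    rewrite E. ring. }
  set (s := g / (2 * (Cmod a + Cmod d + g))).
  pose proof (Cmod_ge_0 a) as Ha.
  assert (Hs : 0 < s < 1).
  { unfold s. split; [apply Rdiv_lt_0_compat; lra|]. apply Rlt_div_l; lra. }
  assert (Hsg : s * (Cmod a + Cmod d) < g).
  { unfold s. replace (g / (2 * (Cmod a + Cmod d + g)) * (Cmod a + Cmod d))
      with (g * ((Cmod a + Cmod d) / (2 * (Cmod a + Cmod d + g)))) by (field; lra).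
    rewrite <- (Rmult_1_r g) at 3. apply Rmult_lt_compat_l; [exact Hg|].
    apply Rlt_div_l; lra. }
  assert (Hs1 : Cmod (RtoC (1 - s)) = 1 - s) by (rewrite Cmod_R; apply Rabs_pos_eq; lra).
  assert (Hs2 : Cmod (RtoC s) = s) by (rewrite Cmod_R; apply Rabs_pos_eq; lra).
  destruct (Hp (RtoC (1 - s) * w)%C) as [_ Hlt].
  { unfold unit_disc. rewrite Cmod_mult, Hs1. nra. }
  replace (c * (RtoC (1 - s) * w) + d)%C with (RtoC s * d)%C in Hlt.
  2:{ rewrite RtoC_minus. unfold w. field. exact Hc0. }
  rewrite Cmod_mult, Hs2 in Hlt.
  replace (a * (RtoC (1 - s) * w) + b)%C with (a * w + b - RtoC s * (a * w))%C in Hlt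
    by (rewrite RtoC_minus; ring).
  pose proof (Cmod_minus_ge (a * w + b) (RtoC s * (a * w))) as Hm.
  rewrite !Cmod_mult, Hs2 in Hm. fold g in Hm.
  assert (Cmod a * Cmod w <= Cmod a) by nra. nra.
Qed.

Lemma ex_derive_C_iff (f : C -> C) (z : C) :
  @ex_derive C_AbsRing C_NormedModule f z <->
  exists l : C, forall eps : posreal, exists delta : posreal, forall y : C,
    Cmod (y - z) < delta -> Cmod (f y - f z - (y - z) * l) <= eps * Cmod (y - z).
Proof.
  split.
  - intros [l [_ H]]. exists l. intros eps.
    destruct (H z (fun P HP => HP) eps) as [delta Hd].
    exists delta. intros y Hy. exact (Hd y Hy).
  - intros [l H]. exists l. split; [apply is_linear_scal_l|].
    intros z' Hz' eps.
    apply (@is_filter_lim_locally_unique C_AbsRing (AbsRing_NormedModule C_AbsRing)) in Hz'.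
    subst z'. destruct (H eps) as [delta Hd].
    exists delta. intros y Hy. exact (Hd y Hy).
Qed.

(** The remainder of the first order expansion at z is
    - D c (y - z)^2 / ((c y + d) (c z + d)^2), with D = a d - b c. *)
Lemma lf_holomorphic (f : C -> C) : lf_self_map f -> holomorphic_on_disc f.
Proof.
  intros (a & b & c & d & Hcd & Hf & _) z Hz. unfold unit_disc in Hz.
  assert (Nz := disc_denominator_neq_0 c d z Hcd (Rlt_le _ _ Hz)).
  assert (HNz := proj1 (Cmod_gt_0 _) Nz).
  set (D := (a * d - b * c)%C).
  apply ex_derive_C_iff.
  exists (D / ((c * z + d) * (c * z + d)))%C. intros eps.
  (* on a small ball the denominator stays above the bound k *)
  set (k := Cmod d - Cmod c).
  assert (Hk : 0 < k) by (unfold k; lra).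
  set (B := Cmod D * Cmod c / (k * (Cmod (c * z + d) * Cmod (c * z + d)))).
  pose proof (Cmod_ge_0 c) as Hc. pose proof (Cmod_ge_0 D) as HD.
  assert (HB : 0 <= B).
  { unfold B. apply Rdiv_le_0_compat; [nra|]. apply Rmult_lt_0_compat; nra. }
  assert (He : 0 < Rmin (1 - Cmod z) (eps / (B + 1))).
  { apply Rmin_pos; [lra|]. apply Rdiv_lt_0_compat; [apply eps|lra]. }
  exists (mkposreal _ He). intros y Hy'. cbn [pos] in Hy'.
  assert (Hyz1 := Rlt_le_trans _ _ _ Hy' (Rmin_l _ _)).
  assert (Hyz2 := Rlt_le_trans _ _ _ Hy' (Rmin_r _ _)).
  assert (Hyd : Cmod y < 1).
  { pose proof (Cmod_triangle (y - z) z) as Ht.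
    replace (y - z + z)%C with y in Ht by ring. lra. }
  assert (Ny := disc_denominator_neq_0 c d y Hcd (Rlt_le _ _ Hyd)).
  rewrite (Hf y Hyd), (Hf z Hz).
  replace ((a * y + b) / (c * y + d) - (a * z + b) / (c * z + d)
           - (y - z) * (D / ((c * z + d) * (c * z + d))))%C
    with (- (D * c) / ((c * y + d) * ((c * z + d) * (c * z + d))) * (y - z) * (y - z))%C
    by (unfold D; field; now split).
  rewrite !Cmod_mult. apply Rmult_le_compat_r; [apply Cmod_ge_0|].
  apply Rle_trans with (B * Cmod (y - z)).
  - apply Rmult_le_compat_r; [apply Cmod_ge_0|].
    assert (HNy := proj1 (Cmod_gt_0 _) Ny).
    rewrite Cmod_div by (apply Cmod_gt_0; rewrite !Cmod_mult; apply Rmult_lt_0_compat; nra).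
    rewrite Cmod_opp, !Cmod_mult. unfold B.
    apply Rmult_le_compat_l; [nra|].
    apply Rinv_le_contravar; [apply Rmult_lt_0_compat; nra|].
    apply Rmult_le_compat_r; [nra|].
    pose proof (Cmod_plus_ge d (c * y)) as Hp. rewrite Cmod_mult in Hp.
    replace (d + c * y)%C with (c * y + d)%C in Hp by ring.
    unfold k. nra.
  - apply Rlt_div_r in Hyz2; [|lra]. pose proof (Cmod_ge_0 (y - z)). nra.
Qed.

(** The value [0] at a pole is arbitrary: there is no pole in the disc when the
    disc is mapped into itself. *)
Definition disc_trace (F : sphere -> sphere) (z : C) : C :=
  match F (Fin z) with Fin w => w | Inf => 0 end.

Lemma disc_trace_Fin (F : sphere -> sphere) (z : C) :
  maps_disc_into_disc F -> unit_disc z ->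
  F (Fin z) = Fin (disc_trace F z) /\ unit_disc (disc_trace F z).
Proof.
  intros HF Hz. destruct (HF z Hz) as (w & Hw & E). unfold disc_trace. now rewrite E.
Qed.

Lemma disc_trace_lf (F : sphere -> sphere) :
  is_mobius F -> maps_disc_into_disc F -> lf_self_map (disc_trace F).
Proof.
  intros (a & b & c & d & Hdet & HF) HD.
  assert (HM : maps_disc_into_disc (mobius a b c d)).
  { intros z Hz. rewrite <- HF. now apply HD. }
  pose proof (mobius_disc_coeffs _ _ _ _ Hdet HM) as Hcd.
  exists a, b, c, d. split; [exact Hcd|]. split; [|split].
  - intros z Hz. unfold disc_trace. rewrite HF, mobius_Fin; [reflexivity|].
    now apply (mobius_disc_pole_free a b c d).
  - intros z Hz. now apply disc_trace_Fin.
  - assert (H0 : unit_disc (RtoC 0)) by (unfold unit_disc; rewrite Cmod_0; lra).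
    assert (H1 : unit_disc (RtoC (/ 2))).
    { unfold unit_disc. rewrite Cmod_R, Rabs_pos_eq; lra. }
    exists (RtoC 0), (RtoC (/ 2)). do 2 (split; [assumption|]). intros E.
    assert (E' : F (Fin (RtoC 0)) = F (Fin (RtoC (/ 2)))).
    { rewrite (proj1 (disc_trace_Fin F _ HD H0)), (proj1 (disc_trace_Fin F _ HD H1)).
      now rewrite E. }
    rewrite !HF in E'.
    apply (f_equal (mobius d (- b) (- c) a)) in E'.
    rewrite !mobius_adjugate in E' by exact Hdet.
    injection E' as E''. lra.
Qed.

Lemma Cmod_le_chordal_dist (z w : C) :
  unit_disc z -> unit_disc w -> Cmod (z - w) <= chordal_dist (Fin z) (Fin w).
Proof.
  unfold unit_disc. intros Hz Hw. unfold chordal_dist.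
  assert (Hb : forall u : C, Cmod u < 1 -> 0 < sqrt (1 + Cmod u ^ 2) <= sqrt 2).
  { intros u Hu. pose proof (Cmod_ge_0 u). split.
    - apply sqrt_lt_R0. nra.
    - apply sqrt_le_1_alt. nra. }
  destruct (Hb z Hz) as [Z1 Z2], (Hb w Hw) as [W1 W2].
  assert (H2 : sqrt 2 * sqrt 2 = 2) by (apply sqrt_sqrt; lra).
  assert (HZW : sqrt (1 + Cmod z ^ 2) * sqrt (1 + Cmod w ^ 2) <= 2).
  { rewrite <- H2. apply Rmult_le_compat; lra. }
  apply Rle_div_r; [now apply Rmult_lt_0_compat|].
  pose proof (Cmod_ge_0 (z - w)). nra.
Qed.

(** The chordal distance dominates the Euclidean one inside the disc, so uniform
    convergence on the sphere gives it on every subset of the disc. *)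
Lemma mobius_group_restricts (Phi : R -> sphere -> sphere) :
  mobius_group Phi -> (forall t, 0 <= t -> maps_disc_into_disc (Phi t)) ->
  lf_semigroup_in_disc (fun t => disc_trace (Phi t)).
Proof.
  intros (Hmob & Hadd & Hcont) HD.
  assert (Hid : forall p, Phi 0 p = p).
  { intros p. destruct (Hmob 0) as (a & b & c & d & Hdet & H0).
    assert (E : Phi 0 (Phi 0 p) = Phi 0 p) by (rewrite <- Hadd; f_equal; ring).
    rewrite !H0 in E. apply (f_equal (mobius d (- b) (- c) a)) in E.
    rewrite !mobius_adjugate in E by exact Hdet. now rewrite H0. }
  assert (Hlf : forall t, 0 <= t -> lf_self_map (disc_trace (Phi t))).
  { intros t Ht. apply disc_trace_lf; auto. }
  split; [|exact Hlf]. split; [|split; [|split]].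
  - intros t Ht. split.
    + intros z Hz. now apply disc_trace_Fin; auto.
    + apply lf_holomorphic; auto.
  - intros z Hz. unfold disc_trace. now rewrite Hid.
  - intros t s Ht Hs z Hz.
    unfold disc_trace at 1. rewrite Hadd.
    rewrite (proj1 (disc_trace_Fin _ z (HD s Hs) Hz)). reflexivity.
  - intros K _ HK eps. unfold at_right, within.
    apply filter_imp with (2 := Hcont 0 eps). intros t Ht Ht0 z Hz.
    change R in t. specialize (Ht (Fin z)). rewrite Hid in Ht.
    destruct (disc_trace_Fin _ z (HD t (Rlt_le 0 t Ht0)) (HK z Hz)) as [E Hd].
    rewrite E in Ht. eapply Rle_lt_trans; [|exact Ht].
    apply Cmod_le_chordal_dist; auto.
Qed.

Lemma Cmod_of_sqr (z : C) (x : R) : 0 <= x -> Cmod z ^ 2 = x ^ 2 -> Cmod z = x.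
Proof. intros Hx H. pose proof (Cmod_ge_0 z). nra. Qed.

(** * Complex powers and roots *)

Lemma unit_circle_param (x y : R) :
  x ^ 2 + y ^ 2 = 1 -> exists theta, cos theta = x /\ sin theta = y.
Proof.
  intros H. assert (Hx : -1 <= x <= 1) by nra.
  assert (Hs : sqrt (1 - x²) = Rabs y).
  { rewrite <- sqrt_Rsqr_abs. f_equal. unfold Rsqr. lra. }
  destruct (Rle_dec 0 y) as [Hy|Hy].
  - exists (acos x). rewrite cos_acos, sin_acos by exact Hx. split; [reflexivity|].
    rewrite Hs. apply Rabs_pos_eq; lra.
  - exists (- acos x). rewrite cos_neg, sin_neg, cos_acos, sin_acos by exact Hx.
    split; [reflexivity|]. rewrite Hs, Rabs_left; lra.
Qed.

(** The powers t |-> l^t for a chosen argument [th] of [l]. *)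
Lemma C_one_parameter_group (l : C) :
  l <> 0 ->
  exists m : R -> C,
    (forall t u, m (t + u) = (m t * m u)%C) /\ m 1 = l /\
    (forall t, Cmod (m t) = exp (t * ln (Cmod l))) /\
    (forall eps : posreal, locally 0 (fun h => Cmod (m h - 1) < eps)).
Proof.
  intros Hl. assert (Hl' := proj1 (Cmod_gt_0 _) Hl).
  set (r := Cmod l) in *.
  pose proof (Cmod2_alt l) as Hsq. fold r in Hsq.
  destruct (unit_circle_param (Re l / r) (Im l / r)) as (th & Hc & Hs).
  { replace ((Re l / r) ^ 2 + (Im l / r) ^ 2) with ((Re l ^ 2 + Im l ^ 2) / r ^ 2)
      by (field; lra).
    rewrite <- Hsq. field. lra. }
  exists (fun t => (exp (t * ln r) * cos (t * th), exp (t * ln r) * sin (t * th))).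
  split; [|split; [|split]].
  - intros t u. rewrite !Rmult_plus_distr_r, exp_plus, cos_plus, sin_plus.
    unfold Cmult; simpl. f_equal; ring.
  - rewrite !Rmult_1_l, exp_ln, Hc, Hs by exact Hl'.
    apply injective_projections; simpl; unfold Re, Im; field; lra.
  - intros t. apply Cmod_of_sqr; [left; apply exp_pos|].
    rewrite Cmod2_alt. simpl.
    pose proof (sin2_cos2 (t * th)) as H. unfold Rsqr in H.
    replace (exp (t * ln r) * (exp (t * ln r) * 1))
      with (exp (t * ln r) * exp (t * ln r) *
            (sin (t * th) * sin (t * th) + cos (t * th) * cos (t * th)))
      by (rewrite H; ring).
    unfold Re, Im; simpl. ring.
  - intros eps.
    assert (He : 0 < eps / 2) by (destruct eps; simpl; lra).
    assert (C1 : continuous (fun t => exp (t * ln r) * cos (t * th)) 0).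
    { apply (@ex_derive_continuous R_AbsRing R_NormedModule). auto_derive. exact I. }
    assert (C2 : continuous (fun t => exp (t * ln r) * sin (t * th)) 0).
    { apply (@ex_derive_continuous R_AbsRing R_NormedModule). auto_derive. exact I. }
    pose proof (C1 _ (locally_ball _ (mkposreal _ He))) as L1.
    pose proof (C2 _ (locally_ball _ (mkposreal _ He))) as L2.
    unfold filtermap in L1, L2.
    apply filter_imp with (2 := filter_and _ _ L1 L2).
    intros h [H1 H2]. change R in h.
    change (Rabs (exp (h * ln r) * cos (h * th) - exp (0 * ln r) * cos (0 * th)) < eps / 2) in H1.
    change (Rabs (exp (h * ln r) * sin (h * th) - exp (0 * ln r) * sin (0 * th)) < eps / 2) in H2.
    rewrite !Rmult_0_l, exp_0, cos_0 in H1. rewrite !Rmult_0_l, exp_0, sin_0 in H2.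
    set (x := exp (h * ln r) * cos (h * th)) in *.
    set (y := exp (h * ln r) * sin (h * th)) in *.
    apply Rle_lt_trans with (Rabs (x - 1) + Rabs y).
    + replace ((x, y) - 1)%C with (RtoC (x - 1) + RtoC y * Ci)%C
        by (apply injective_projections; simpl; ring).
      eapply Rle_trans; [apply Cmod_triangle|].
      rewrite Cmod_mult, Cmod_Ci, !Cmod_R. lra.
    + replace (x - 1) with (x - 1 * 1) by ring.
      replace (Rabs y) with (Rabs (y - 1 * 0)) by (f_equal; ring). lra.
Qed.

Lemma C_sqrt_exists (w : C) : exists u : C, (u * u)%C = w.
Proof.
  destruct (Ceq_dec w 0) as [->|Hw]; [exists (RtoC 0); ring|].
  destruct (C_one_parameter_group w Hw) as (m & Hm & H1 & _).
  exists (m (/ 2)). rewrite <- Hm, <- H1. f_equal. field.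
Qed.

Lemma C_quadratic_root (p q r : C) :
  p <> 0 -> exists z : C, (p * z * z + q * z + r)%C = 0.
Proof.
  intros Hp. destruct (C_sqrt_exists (q * q - 4 * p * r)) as [u Hu].
  assert (H2 : RtoC 2 <> 0) by (intros E; apply RtoC_inj in E; lra).
  assert (H4 : RtoC 4 <> 0) by (intros E; apply RtoC_inj in E; lra).
  exists ((u - q) / (2 * p))%C.
  replace (p * ((u - q) / (2 * p)) * ((u - q) / (2 * p)) + q * ((u - q) / (2 * p)) + r)%C
    with ((u * u - (q * q - 4 * p * r)) / (4 * p))%C.
  - rewrite Hu. field. repeat split; assumption.
  - field. repeat split; assumption.
Qed.

Lemma C_polar (z : C) : exists u : C, Cmod u = 1 /\ z = (RtoC (Cmod z) * u)%C.
Proof.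
  destruct (Ceq_dec z 0) as [->|Hz].
  - exists (RtoC 1). rewrite Cmod_1, Cmod_0. split; [reflexivity|ring].
  - assert (Hz' := proj1 (Cmod_gt_0 _) Hz).
    assert (Hn : RtoC (Cmod z) <> 0) by (intros E; apply RtoC_inj in E; lra).
    exists (z / RtoC (Cmod z))%C. split; [|field; exact Hn].
    rewrite Cmod_div, Cmod_R, Rabs_pos_eq by (assumption || lra). field. lra.
Qed.

(** * Fixed points of linear fractional self-maps *)

(** Rotating the variable by [u] gives q w and r the common direction [v], so that
    triangle inequalities between them become equalities. *)
Lemma C_align (q r : C) :
  exists u v : C, Cmod u = 1 /\ Cmod v = 1 /\
    (q * u)%C = (RtoC (Cmod q) * v)%C /\ r = (RtoC (Cmod r) * v)%C.
Proof.
  destruct (C_polar q) as (x & Hx & Eq). destruct (C_polar r) as (v & Hv & Er).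
  exists (v * Cconj x)%C, v. rewrite Cmod_mult, Cmod_conj, Hx, Hv.
  repeat split; try lra; [|exact Er].
  rewrite Eq at 1.
  replace (RtoC (Cmod q) * x * (v * Cconj x))%C
    with (RtoC (Cmod q) * v * (x * Cconj x))%C by ring.
  rewrite <- Cmod2_conj, Hx. rewrite pow1. ring.
Qed.

Lemma Cmod_RtoC_pos (x : R) : 0 <= x -> Cmod (RtoC x) = x.
Proof. intros H. now rewrite Cmod_R, Rabs_pos_eq. Qed.

(** If |p| + |q| > |r|, then at |w| = |r| / (|p| + |q|) < 1, with q w pointing
    against r, both sides equal |p w|. *)
Lemma coeff_bound_below (p q r : C) :
  (forall w, unit_disc w -> Cmod (p * w) < Cmod (q * w + r)) ->
  Cmod p + Cmod q <= Cmod r.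
Proof.
  intros H. apply Rnot_lt_le. intros Hlt.
  pose proof (Cmod_ge_0 r) as Hr. set (k := Cmod p + Cmod q) in *.
  destruct (C_align q r) as (u & v & Hu & Hv & Eq & Er).
  set (s := Cmod r / k).
  assert (Hs : 0 <= s < 1).
  { unfold s. split; [apply Rdiv_le_0_compat; lra|]. apply Rlt_div_l; lra. }
  assert (Hsk : s * k = Cmod r) by (unfold s; field; lra).
  specialize (H (- (RtoC s * u))%C). apply (Rlt_irrefl (s * Cmod p)).
  assert (Hm : Cmod (- (RtoC s * u)) = s).
  { rewrite Cmod_opp, Cmod_mult, Hu, Cmod_RtoC_pos; lra. }
  unfold unit_disc in H. rewrite Hm, Cmod_mult, Hm in H.
  replace (q * - (RtoC s * u) + r)%C with (RtoC (s * Cmod p) * v)%C in H.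
  - rewrite Cmod_mult, Hv, Cmod_RtoC_pos in H.
    + lra.
    + apply Rmult_le_pos; [lra|apply Cmod_ge_0].
  - replace (s * Cmod p) with (Cmod r - s * Cmod q) by (unfold k in Hsk; lra).
    replace (q * - (RtoC s * u) + r)%C with (r - RtoC s * (q * u))%C by ring.
    rewrite Eq, RtoC_minus, RtoC_mult. rewrite Er at 2. ring.
Qed.

Lemma coeff_bound_above (q r : C) (k : R) :
  (forall w, unit_disc w -> Cmod (q * w + r) < k) -> Cmod q + Cmod r <= k.
Proof.
  intros H. apply Rnot_lt_le. intros Hlt.
  assert (Hr : Cmod r < k).
  { replace r with (q * 0 + r)%C by ring. apply H. unfold unit_disc. rewrite Cmod_0. lra. }
  destruct (C_align q r) as (u & v & Hu & Hv & Eq & Er).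
  set (s := (k - Cmod r) / Cmod q).
  assert (Hs : 0 <= s < 1).
  { unfold s. split; [apply Rdiv_le_0_compat; lra|]. apply Rlt_div_l; lra. }
  assert (Hsq : s * Cmod q = k - Cmod r) by (unfold s; field; lra).
  specialize (H (RtoC s * u)%C). unfold unit_disc in H.
  rewrite Cmod_mult, Hu, Cmod_RtoC_pos in H by lra.
  replace (q * (RtoC s * u) + r)%C with (RtoC k * v)%C in H.
  - rewrite Cmod_mult, Hv, Cmod_RtoC_pos in H by (pose proof (Cmod_ge_0 r); lra). lra.
  - replace k with (s * Cmod q + Cmod r) by lra.
    replace (q * (RtoC s * u) + r)%C with (RtoC s * (q * u) + r)%C by ring.
    rewrite Eq, RtoC_plus, RtoC_mult. rewrite Er at 2. ring.
Qed.

(** For y = 1 this is the identity behind the disc automorphism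
    (x - z) / (1 - conj z x); the homogeneous version applies to fractions x / y. *)
Lemma Blaschke_identity (x y z : C) :
  Cmod (y - Cconj z * x) ^ 2 - Cmod (x - z * y) ^ 2
  = (Cmod y ^ 2 - Cmod x ^ 2) * (1 - Cmod z ^ 2).
Proof.
  destruct x as [x1 x2], y as [y1 y2], z as [z1 z2].
  rewrite !Cmod2_alt. unfold Re, Im; simpl. ring.
Qed.

Lemma disc_automorphism (z w : C) :
  unit_disc z -> unit_disc w ->
  (Cconj z * w + 1)%C <> 0 /\ unit_disc ((w + z) / (Cconj z * w + 1))%C.
Proof.
  unfold unit_disc. intros Hz Hw.
  pose proof (Cmod_ge_0 z). pose proof (Cmod_ge_0 w).
  assert (N : (Cconj z * w + 1)%C <> 0).
  { apply disc_denominator_neq_0; [rewrite Cmod_conj, Cmod_1|]; lra. }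
  split; [exact N|]. apply unit_disc_div; [exact N|]. apply Cmod_lt_sqr.
  pose proof (Blaschke_identity w 1 (- z)) as HB.
  rewrite Cmod_opp, Cmod_1 in HB.
  replace (1 - Cconj (- z) * w)%C with (Cconj z * w + 1)%C in HB
    by (rewrite Copp_conj; ring).
  replace (w - - z * 1)%C with (w + z)%C in HB by ring.
  assert (0 < (1 ^ 2 - Cmod w ^ 2) * (1 - Cmod z ^ 2)) by (apply Rmult_lt_0_compat; nra).
  lra.
Qed.

Lemma Cconj_mult_sqr (z : C) : (Cconj z * z)%C = RtoC (Cmod z ^ 2).
Proof. rewrite Cmod2_conj. ring. Qed.

(** The fixed point equation cleared of its denominator.  With e = d - a + c z,
    the second root is - e / c, read as infinity when c = 0. *)
Definition fixed_eq (a b c d z : C) : Prop := (c * z * z + (d - a) * z - b)%C = 0.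

Lemma fixed_eq_b (a b c d z : C) : fixed_eq a b c d z -> b = (c * z * z + (d - a) * z)%C.
Proof.
  unfold fixed_eq. intros H.
  replace b with (c * z * z + (d - a) * z - (c * z * z + (d - a) * z - b))%C by ring.
  rewrite H. ring.
Qed.

(** Conjugating by the disc automorphism that sends z to 0 turns the map into
    w |-> (a - c z) w / ((c + conj z e) w + (c z + d)), with e = d - a + c z, up to the
    common factor 1 - |z|^2; it still maps the disc into itself, which bounds its
    coefficients.  In particular the multiplier (a - c z) / (c z + d) at an
    interior fixed point has modulus at most 1, and modulus 1 forces
    c + conj z e = 0, that is, the reflected point 1 / conj z is fixed as well. *)
Lemma interior_fixed_bound (a b c d : C) (f : C -> C) (z : C) :
  lf_self_map_coeffs a b c d f ->
  unit_disc z -> fixed_eq a b c d z ->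
  Cmod (a - c * z) + Cmod (c + Cconj z * (d - a + c * z)) <= Cmod (c * z + d).
Proof.
  intros Hf Hz Hfix. pose proof (Cmod_ge_0 z) as Hz0.
  apply coeff_bound_below. intros w Hw.
  destruct (disc_automorphism z w Hz Hw) as [N1 Hu].
  set (u := ((w + z) / (Cconj z * w + 1))%C) in *.
  set (k := RtoC (1 - Cmod z ^ 2)).
  assert (Hk : 0 < 1 - Cmod z ^ 2) by (unfold unit_disc in Hz; nra).
  pose proof (lf_coeffs_bound _ _ _ _ _ _ Hf Hu) as Hlt.
  (* |v - z| < |1 - conj z v| for v = f u, multiplied by the denominator of v *)
  assert (Hpick : Cmod ((a * u + b) - z * (c * u + d))
                  < Cmod ((c * u + d) - Cconj z * (a * u + b))).
  { apply Cmod_lt_sqr.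
    pose proof (Blaschke_identity (a * u + b) (c * u + d) z) as Hid.
    pose proof (Cmod_ge_0 (a * u + b)).
    assert (0 < (Cmod (c * u + d) ^ 2 - Cmod (a * u + b) ^ 2) * (1 - Cmod z ^ 2)).
    { apply Rmult_lt_0_compat; nra. }
    lra. }
  apply (Rmult_lt_compat_l (Cmod (Cconj z * w + 1))) in Hpick;
    [|now apply Cmod_gt_0].
  rewrite <- !Cmod_mult in Hpick.
  pose proof (Cconj_mult_sqr z) as Hzz.
  assert (Ek : k = (1 - Cconj z * z)%C) by (unfold k; rewrite RtoC_minus, Hzz; reflexivity).
  replace ((Cconj z * w + 1) * (a * u + b - z * (c * u + d)))%C
    with (k * ((a - c * z) * w))%C in Hpick.
  2:{ rewrite Ek, (fixed_eq_b a b c d z Hfix). unfold u. field. exact N1. }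
  replace ((Cconj z * w + 1) * (c * u + d - Cconj z * (a * u + b)))%C
    with (k * ((c + Cconj z * (d - a + c * z)) * w + (c * z + d)))%C in Hpick.
  2:{ rewrite Ek, (fixed_eq_b a b c d z Hfix). unfold u. field. exact N1. }
  rewrite (Cmod_mult k), (Cmod_mult k) in Hpick.
  apply Rmult_lt_reg_l in Hpick; [exact Hpick|].
  unfold k. rewrite Cmod_RtoC_pos; lra.
Qed.

(** Dual to the interior case: the automorphism sending z to infinity makes the map
    affine, w |-> ((c z + d) w + (c + conj z e)) / (a - c z). *)
Lemma exterior_fixed_bound (a b c d : C) (f : C -> C) (z : C) :
  lf_self_map_coeffs a b c d f ->
  1 < Cmod z -> fixed_eq a b c d z ->
  Cmod (c * z + d) + Cmod (c + Cconj z * (d - a + c * z)) <= Cmod (a - c * z).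
Proof.
  intros Hf Hz Hfix. 
  apply coeff_bound_above. intros w Hw. unfold unit_disc in Hw.
  pose proof (Cmod_ge_0 w) as Hw0.
  assert (N1 : (1 * w + Cconj z)%C <> 0).
  { apply disc_denominator_neq_0; [rewrite Cmod_conj, Cmod_1|]; lra. }
  replace (1 * w + Cconj z)%C with (w + Cconj z)%C in N1 by ring.
  set (u := ((z * w + 1) / (w + Cconj z))%C).
  set (k := RtoC (Cmod z ^ 2 - 1)).
  assert (Hk : 0 < Cmod z ^ 2 - 1) by nra.
  assert (Hu : unit_disc u).
  { apply unit_disc_div; [exact N1|]. apply Cmod_lt_sqr.
    pose proof (Blaschke_identity w 1 (- Cconj z)) as HB.
    rewrite Cmod_opp, Cmod_conj, Cmod_1 in HB.
    replace (1 - Cconj (- Cconj z) * w)%C with (z * w + 1)%C in HB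
      by (rewrite Copp_conj, Cconj_conj; ring).
    replace (w - - Cconj z * 1)%C with (w + Cconj z)%C in HB by ring.
    assert (0 < (1 ^ 2 - Cmod w ^ 2) * (Cmod z ^ 2 - 1)) by (apply Rmult_lt_0_compat; nra).
    lra. }
  pose proof (lf_coeffs_bound _ _ _ _ _ _ Hf Hu) as Hlt.
  assert (Hpick : Cmod ((c * u + d) - Cconj z * (a * u + b))
                  < Cmod ((a * u + b) - z * (c * u + d))).
  { apply Cmod_lt_sqr.
    pose proof (Blaschke_identity (a * u + b) (c * u + d) z) as Hid.
    pose proof (Cmod_ge_0 (a * u + b)).
    assert (0 < (Cmod (c * u + d) ^ 2 - Cmod (a * u + b) ^ 2) * (Cmod z ^ 2 - 1)).
    { apply Rmult_lt_0_compat; nra. }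
    lra. }
  apply (Rmult_lt_compat_l (Cmod (w + Cconj z))) in Hpick;
    [|now apply Cmod_gt_0].
  rewrite <- !Cmod_mult in Hpick.
  pose proof (Cconj_mult_sqr z) as Hzz.
  assert (Ek : k = (Cconj z * z - 1)%C) by (unfold k; rewrite RtoC_minus, Hzz; reflexivity).
  replace ((w + Cconj z) * (a * u + b - z * (c * u + d)))%C
    with (- (k * (a - c * z)))%C in Hpick.
  2:{ rewrite Ek, (fixed_eq_b a b c d z Hfix). unfold u. field. exact N1. }
  replace ((w + Cconj z) * (c * u + d - Cconj z * (a * u + b)))%C
    with (- (k * ((c * z + d) * w + (c + Cconj z * (d - a + c * z)))))%C in Hpick.
  2:{ rewrite Ek, (fixed_eq_b a b c d z Hfix). unfold u. field. exact N1. }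
  rewrite !Cmod_opp, (Cmod_mult k), (Cmod_mult k) in Hpick.
  apply Rmult_lt_reg_l in Hpick; [exact Hpick|].
  unfold k. rewrite Cmod_RtoC_pos; lra.
Qed.

(** Brouwer's theorem for linear fractional maps.  An affine self-map of the disc
    fixes b / (d - a), and |b| <= |d| - |a| <= |d - a|.  In general, when one fixed point
    lies outside the closed disc, the same estimate in the coordinate in which
    it is infinity places the other one inside. *)
Lemma fixed_point_in_closed_disc (a b c d : C) (f : C -> C) :
  lf_self_map_coeffs a b c d f -> exists z, Cmod z <= 1 /\ fixed_eq a b c d z.
Proof.
  intros Hf.
  pose proof (proj1 Hf) as Hcd.
  destruct (Ceq_dec c 0) as [Hc|Hc].
  - assert (Hab : Cmod a + Cmod b <= Cmod d).
    { apply coeff_bound_above. intros w Hw.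
      pose proof (lf_coeffs_bound _ _ _ _ _ _ Hf Hw) as H.
      rewrite Hc in H. replace (0 * w + d)%C with d in H by ring. exact H. }
    destruct (Ceq_dec (d - a) 0) as [E|E].
    + exists (RtoC 0). rewrite Cmod_0. split; [lra|].
      assert (Eda : d = a) by (replace d with (d - a + a)%C by ring; rewrite E; ring).
      rewrite Eda in Hab. pose proof (Cmod_ge_0 b).
      assert (Hb : b = 0) by (apply Cmod_eq_0; lra).
      unfold fixed_eq. rewrite Hb. ring.
    + exists (b / (d - a))%C. split.
      * rewrite Cmod_div by exact E. apply Rle_div_l; [now apply Cmod_gt_0|].
        pose proof (Cmod_minus_ge d a). lra.
      * unfold fixed_eq. rewrite Hc. field. exact E.
  - destruct (C_quadratic_root c (d - a) (- b) Hc) as [z Hz].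
    destruct (Rle_lt_dec (Cmod z) 1) as [Hle|Hlt].
    + exists z. split; [exact Hle|]. unfold fixed_eq. rewrite <- Hz. ring.
    + assert (Hfix : fixed_eq a b c d z) by (unfold fixed_eq; rewrite <- Hz; ring).
      set (e := (d - a + c * z)%C).
      exists (- e / c)%C. split.
      * rewrite Cmod_div, Cmod_opp by exact Hc.
        apply Rle_div_l; [now apply Cmod_gt_0|]. rewrite Rmult_1_l.
        pose proof (exterior_fixed_bound a b c d f z Hf Hlt Hfix) as HB. fold e in HB.
        pose proof (Cmod_minus_ge (a - c * z) (c * z + d)) as H1.
        replace (a - c * z - (c * z + d))%C with (- (e + c * z))%C in H1
          by (unfold e; ring).
        rewrite Cmod_opp in H1.
        assert (H2 : Cmod (c + Cconj z * e) <= Cmod (e + c * z)) by lra.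
        (* this identity turns the estimate into |e| <= |c|, for the root - e / c *)
        assert (Hid : Cmod (c + Cconj z * e) ^ 2 - Cmod (e + c * z) ^ 2
                      = (Cmod z ^ 2 - 1) * (Cmod e ^ 2 - Cmod c ^ 2)).
        { clear. clearbody e. destruct z as [z1 z2], e as [e1 e2], c as [c1 c2].
          rewrite !Cmod2_alt. unfold Re, Im; simpl. ring. }
        apply Cmod_le_sqr. pose proof (Cmod_ge_0 (c + Cconj z * e)). 
        assert (Hneg : (Cmod z ^ 2 - 1) * (Cmod e ^ 2 - Cmod c ^ 2) <= 0) by nra.
        assert (0 < Cmod z ^ 2 - 1) by nra. nra.
      * unfold fixed_eq. rewrite (fixed_eq_b a b c d z Hfix). unfold e. field. exact Hc.
Qed.

Definition embeds_in_mobius_group (a b c d : C) : Prop :=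
  exists Phi : R -> sphere -> sphere,
    mobius_group Phi /\
    (forall t : R, 0 <= t -> maps_disc_into_disc (Phi t)) /\
    (forall p : sphere, Phi 1 p = mobius a b c d p).

(** The equations say that the matrix of the affine map times S is k times S
    times the matrix of the given map, where S = (p q; r s). *)
Lemma affine_conj_intertwine (p q r s k a b c d : C) (m n : R -> C) (t : R) (z : sphere) :
  (p * s - q * r)%C <> 0 -> (a * d - b * c)%C <> 0 -> k <> 0 ->
  (m t * p + n t * r)%C = (k * (p * a + q * c))%C ->
  (m t * q + n t * s)%C = (k * (p * b + q * d))%C ->
  r = (k * (r * a + s * c))%C ->
  s = (k * (r * b + s * d))%C ->
  affine_conj p q r s m n t z = mobius a b c d z.
Proof.
  intros HS HM Hk E1 E2 E3 E4. unfold affine_conj.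
  rewrite <- (mobius_adjugate p q r s (mobius a b c d z)) by exact HS.
  f_equal. rewrite !mobius_comp by assumption.
  rewrite <- (mobius_scale k (p * a + q * c)) by exact Hk.
  rewrite <- E1, <- E2, <- E3, <- E4. f_equal; ring.
Qed.

(** The two factors are the multiplier's denominator and numerator, so both are
    non-zero for an invertible matrix. *)
Lemma fixed_det (a b c d z : C) :
  fixed_eq a b c d z -> (a * d - b * c)%C = ((c * z + d) * (a - c * z))%C.
Proof. intros H. rewrite (fixed_eq_b _ _ _ _ _ H). ring. Qed.

Lemma fixed_factors_neq_0 (a b c d z : C) :
  (a * d - b * c)%C <> 0 -> fixed_eq a b c d z ->
  (c * z + d)%C <> 0 /\ (a - c * z)%C <> 0.
Proof.
  intros Hdet H. rewrite (fixed_det _ _ _ _ _ H) in Hdet.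
  split; intros E; apply Hdet; rewrite E; ring.
Qed.

(** * A fixed point on the unit circle *)

(** Moving w vertically excludes Im al <> 0, letting w tend to +oo excludes
    Re al < 0, and letting w tend to 0 excludes Re be < 0. *)
Lemma affine_half_plane (al be : C) :
  al <> 0 -> (forall w : C, 0 < Re w -> 0 < Re (al * w + be)%C) ->
  Im al = 0 /\ 0 < Re al /\ 0 <= Re be.
Proof.
  destruct al as [a1 a2], be as [b1 b2]. unfold Re, Im. simpl.
  intros Hne H.
  assert (H' : forall x y, 0 < x -> 0 < a1 * x - a2 * y + b1).
  { intros x y Hx. exact (H (x, y) Hx). }
  assert (H2 : a2 = 0).
  { destruct (Req_dec a2 0) as [|Hn]; [assumption|exfalso].
    pose proof (H' 1 ((a1 + b1) / a2) Rlt_0_1) as H1.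
    replace (a1 * 1 - a2 * ((a1 + b1) / a2) + b1) with 0 in H1 by (field; exact Hn). lra. }
  assert (H3 : forall x, 0 < x -> 0 < a1 * x + b1).
  { intros x Hx. pose proof (H' x 0 Hx). lra. }
  assert (Ha : 0 < a1).
  { destruct (Rtotal_order a1 0) as [Hn|[Hz|]]; [|exfalso; apply Hne; now subst|assumption].
    exfalso. assert (Hx : 0 < (Rabs b1 + 1) / - a1).
    { apply Rdiv_lt_0_compat; [pose proof (Rabs_pos b1)|]; lra. }
    pose proof (H3 _ Hx) as H1.
    replace (a1 * ((Rabs b1 + 1) / - a1)) with (- (Rabs b1 + 1)) in H1 by (field; lra).
    pose proof (Rle_abs b1). lra. }
  split; [exact H2|split; [exact Ha|]].
  apply Rnot_lt_le. intros Hb.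
  assert (Hx : 0 < - b1 / (2 * a1)) by (apply Rdiv_lt_0_compat; lra).
  pose proof (H3 _ Hx) as H1.
  replace (a1 * (- b1 / (2 * a1))) with (- b1 / 2) in H1 by (field; lra). lra.
Qed.

Lemma Cayley_Re (tau z : C) :
  Cmod tau = 1 -> (tau - z)%C <> 0 ->
  Re ((z + tau) / (tau - z))%C = (1 - Cmod z ^ 2) / Cmod (tau - z) ^ 2.
Proof.
  intros Ht Hn.
  assert (Hn' := proj1 (Cmod_gt_0 _) Hn).
  assert (E : ((z + tau) / (tau - z))%C
              = ((z + tau) * Cconj (tau - z) * RtoC (/ Cmod (tau - z) ^ 2))%C).
  { rewrite RtoC_inv, Cmod2_conj by (apply pow_nonzero; lra). field. split; [|exact Hn].
    apply Cmod_gt_0. rewrite Cmod_conj. exact Hn'. }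
  rewrite E. clear E.
  assert (Ht2 : Cmod tau ^ 2 = 1) by (rewrite Ht; ring).
  unfold Rdiv. set (i := / Cmod (tau - z) ^ 2).
  rewrite Cmod2_alt in *. destruct tau as [t1 t2], z as [z1 z2].
  unfold Re, Im in *; simpl in *. clearbody i.
  transitivity ((t1 * (t1 * 1) + t2 * (t2 * 1) - (z1 * (z1 * 1) + z2 * (z2 * 1))) * i);
    [ring|]. rewrite Ht2. reflexivity.
Qed.

Lemma Cayley_inv_disc (tau w : C) :
  Cmod tau = 1 -> 0 < Re w ->
  (w + 1)%C <> 0 /\ unit_disc (tau * (w - 1) / (w + 1))%C.
Proof.
  intros Ht Hw.
  assert (Hlt : Cmod (w - 1) < Cmod (w + 1)).
  { apply Cmod_lt_sqr. rewrite !Cmod2_alt. destruct w as [w1 w2].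
    unfold Re, Im in *; simpl in *. nra. }
  assert (Hn : (w + 1)%C <> 0).
  { apply Cmod_gt_0. pose proof (Cmod_ge_0 (w - 1)). lra. }
  split; [exact Hn|]. apply unit_disc_div; [exact Hn|].
  rewrite Cmod_mult, Ht. lra.
Qed.

(** Here g t is (al^t - 1) / (al - 1), or t when al = 1: the translation part of the
    t-th iterate of w |-> al w + 1.  It is nonnegative for t >= 0 whether al is
    above or below 1. *)
Lemma affine_cocycle (al : R) :
  0 < al ->
  exists g : R -> R,
    (forall t u, g (t + u) = exp (t * ln al) * g u + g t) /\ g 1 = 1 /\
    (forall t, 0 <= t -> 0 <= g t) /\
    (forall eps : posreal, locally 0 (fun h => Rabs (g h) < eps)).
Proof.
  intros Hal.
  assert (Hloc : forall g : R -> R, g 0 = 0 -> continuous g 0 ->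
            forall eps : posreal, locally 0 (fun h => Rabs (g h) < eps)).
  { intros g H0 Hc eps. pose proof (Hc _ (locally_ball _ eps)) as L.
    unfold filtermap in L. apply filter_imp with (2 := L). intros h Hh.
    change R in h. change (Rabs (g h - g 0) < eps) in Hh.
    rewrite H0, Rminus_0_r in Hh. exact Hh. }
  destruct (Req_dec al 1) as [->|H1].
  - exists (fun t => t). rewrite ln_1. repeat split.
    + intros t u. rewrite Rmult_0_r, exp_0. ring.
    + intros t Ht. exact Ht.
    + apply Hloc; [reflexivity|apply continuous_id].
  - exists (fun t => (exp (t * ln al) - 1) / (al - 1)). repeat split.
    + intros t u. rewrite Rmult_plus_distr_r, exp_plus. field. lra.
    + rewrite Rmult_1_l, exp_ln by exact Hal. field. lra.
    + intros t Ht. destruct (Rlt_le_dec 1 al) as [Hlt|Hle].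
      * assert (Hln : 0 < ln al) by (rewrite <- ln_1; apply ln_increasing; lra).
        apply Rdiv_le_0_compat; [|lra].
        assert (exp 0 <= exp (t * ln al)).
        { destruct Ht as [Ht| <-]; [left; apply exp_increasing; nra|].
          rewrite Rmult_0_l. lra. }
        rewrite exp_0 in *. lra.
      * assert (Hln : ln al < 0) by (rewrite <- ln_1; apply ln_increasing; lra).
        assert (exp (t * ln al) <= exp 0).
        { destruct Ht as [Ht| <-]; [left; apply exp_increasing; nra|].
          rewrite Rmult_0_l. lra. }
        rewrite exp_0 in *.
        replace ((exp (t * ln al) - 1) / (al - 1))
          with ((1 - exp (t * ln al)) / (1 - al)) by (field; lra).
        apply Rdiv_le_0_compat; lra.
    + apply Hloc.
      * rewrite Rmult_0_l, exp_0. field. lra.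
      * apply (@ex_derive_continuous R_AbsRing R_NormedModule).
        auto_derive. lra.
Qed.

(** The Cayley transform (z + tau) / (tau - z) sends the disc to the right half-plane and
    tau to infinity.  The map becomes affine there, with al > 0 and Re be >= 0, and
    the affine flow al^t w + be g(t) preserves the half-plane for t >= 0. *)
Lemma boundary_fixed_point_embeds (a b c d tau : C) (f : C -> C) :
  lf_self_map_coeffs a b c d f -> Cmod tau = 1 -> fixed_eq a b c d tau ->
  embeds_in_mobius_group a b c d.
Proof.
  intros Hf Ht Hfix.
  pose proof (lf_coeffs_det _ _ _ _ _ Hf) as Hdet.
  destruct (fixed_factors_neq_0 _ _ _ _ _ Hdet Hfix) as [N1 N2].
  assert (Ht0 : tau <> 0) by (apply Cmod_gt_0; lra).
  assert (H2 : RtoC 2 <> 0) by (intros E; apply RtoC_inj in E; lra).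
  set (al := ((c * tau + d) / (a - c * tau))%C).
  set (be := ((d - a) / (a - c * tau))%C).
  assert (Hal0 : al <> 0) by (now apply Cdiv_neq_0).
  assert (Hout : forall z, unit_disc z -> (tau - z)%C <> 0).
  { intros z Hz E. unfold unit_disc in Hz.
    replace z with (tau - (tau - z))%C in Hz by ring.
    rewrite E in Hz. replace (tau - 0)%C with tau in Hz by ring. lra. }
  assert (Hhalf : forall z, unit_disc z -> 0 < Re ((z + tau) / (tau - z))%C).
  { intros z Hz. rewrite Cayley_Re by auto.
    assert (Hp := proj1 (Cmod_gt_0 _) (Hout z Hz)).
    unfold unit_disc in Hz. pose proof (Cmod_ge_0 z).
    apply Rdiv_lt_0_compat; [nra|apply pow_lt; exact Hp]. }
  destruct (affine_half_plane al be Hal0) as (Ha2 & Ha1 & Hb1).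
  { intros w Hw. destruct (Cayley_inv_disc tau w Ht Hw) as [Nw Hz].
    set (z := (tau * (w - 1) / (w + 1))%C) in *.
    destruct Hf as (Hcd & Hfe & Hfs & _).
    assert (Nz : (c * z + d)%C <> 0).
    { apply disc_denominator_neq_0; [exact Hcd|]. unfold unit_disc in Hz. lra. }
    pose proof (Hfs z Hz) as Hfz. rewrite (Hfe z Hz) in Hfz.
    pose proof (Hhalf _ Hfz) as Hre. pose proof (Hout _ Hfz) as Hne.
    (* the Cayley transform turns [f] into [w |-> al * w + be] *)
    replace (al * w + be)%C
      with (((a * z + b) / (c * z + d) + tau) / (tau - (a * z + b) / (c * z + d)))%C;
      [exact Hre|].
    assert (N3 : (c * (tau * (w - 1)) + d * (w + 1))%C <> 0).
    { intros E. apply Nz.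
      replace (c * z + d)%C with ((c * (tau * (w - 1)) + d * (w + 1)) / (w + 1))%C
        by (unfold z; field; exact Nw).
      rewrite E. field. exact Nw. }
    assert (Ez : (tau - (a * z + b) / (c * z + d))%C
                 = (2 * tau * (a - c * tau) / ((c * z + d) * (w + 1)))%C).
    { rewrite (fixed_eq_b _ _ _ _ _ Hfix). unfold z. field.
      split; assumption. }
    assert (Ez' : ((a * z + b) / (c * z + d) + tau)%C
                 = (2 * tau * ((c * tau + d) * w + (d - a)) / ((c * z + d) * (w + 1)))%C).
    { rewrite (fixed_eq_b _ _ _ _ _ Hfix). unfold z. field.
      split; assumption. }
    rewrite Ez, Ez'. unfold al, be. field. repeat split; assumption. }
  destruct (affine_cocycle (Re al) Ha1) as (g & Hg & Hg1 & Hgpos & Hgc).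
  assert (Eal : al = RtoC (Re al)).
  { apply injective_projections; simpl; [reflexivity|exact Ha2]. }
  set (m := fun t : R => RtoC (exp (t * ln (Re al)))).
  set (n := fun t : R => (be * RtoC (g t))%C).
  assert (Hm0 : forall t, m t <> 0).
  { intros t E. apply RtoC_inj in E. pose proof (exp_pos (t * ln (Re al))). lra. }
  assert (HS : (1 * tau - tau * -1)%C <> 0).
  { replace (1 * tau - tau * -1)%C with (2 * tau)%C by ring.
    intros E. destruct (Cmult_integral _ _ E); contradiction. }
  exists (affine_conj 1 tau (-1)%C tau m n). split; [|split].
  - apply affine_conj_group; auto.
    + intros t u. unfold m. rewrite Rmult_plus_distr_r, exp_plus, RtoC_mult. reflexivity.
    + intros t u. unfold n, m. rewrite Hg, RtoC_plus, RtoC_mult. ring.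
    + intros eps.
      assert (Hc : continuous (fun t => exp (t * ln (Re al))) 0).
      { apply (@ex_derive_continuous R_AbsRing R_NormedModule). auto_derive. exact I. }
      pose proof (Hc _ (locally_ball _ eps)) as L. unfold filtermap in L.
      apply filter_imp with (2 := L). intros h Hh. change R in h.
      change (Rabs (exp (h * ln (Re al)) - exp (0 * ln (Re al))) < eps) in Hh.
      rewrite Rmult_0_l, exp_0 in Hh. unfold m. rewrite <- RtoC_minus, Cmod_R. exact Hh.
    + intros eps. pose proof (Cmod_ge_0 be) as Hbe.
      assert (He : 0 < eps / (Cmod be + 1)).
      { apply Rdiv_lt_0_compat; [apply eps|lra]. }
      apply filter_imp with (2 := Hgc (mkposreal _ He)). intros h Hh. simpl in Hh.
      unfold n. rewrite Cmod_mult, Cmod_R.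
      apply Rlt_div_r in Hh; [|lra]. pose proof (Rabs_pos (g h)). nra.
  - intros t Ht' z Hz. unfold affine_conj.
    assert (Nz := Hout z Hz). pose proof (Hhalf z Hz) as Hre.
    rewrite (mobius_Fin 1 tau (-1)%C tau).
    2:{ replace (-1 * z + tau)%C with (tau - z)%C by ring. exact Nz. }
    set (w := ((1 * z + tau) / (-1 * z + tau))%C).
    assert (Hw : 0 < Re w).
    { replace w with ((z + tau) / (tau - z))%C; [exact Hre|].
      unfold w. f_equal; ring. }
    rewrite mobius_Fin.
    2:{ replace (0 * w + 1)%C with (RtoC 1) by ring. exact C1_nz. }
    set (w' := ((m t * w + n t) / (0 * w + 1))%C).
    assert (Hw' : 0 < Re w').
    { replace w' with (m t * w + n t)%C.
      2:{ unfold w'. replace (0 * w + 1)%C with (RtoC 1) by ring. field. }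
      unfold m, n. pose proof (exp_pos (t * ln (Re al))) as He.
      pose proof (Hgpos t Ht') as Hgt. clear - Hw He Hgt Hb1.
      set (E := exp (t * ln (Re al))) in *. clearbody E.
      destruct w as [w1 w2], be as [b1 b2]. unfold Re in *; simpl in *.
      assert (0 < E * w1) by now apply Rmult_lt_0_compat.
      assert (0 <= b1 * g t) by now apply Rmult_le_pos. lra. }
    destruct (Cayley_inv_disc tau w' Ht Hw') as [Nw Hd].
    exists (tau * (w' - 1) / (w' + 1))%C. split; [exact Hd|].
    rewrite mobius_Fin.
    + do 2 f_equal; ring.
    + replace (- -1 * w' + 1)%C with (w' + 1)%C by ring. exact Nw.
  - intros z. apply (affine_conj_intertwine _ _ _ _ (/ (a - c * tau))%C); auto.
    + intros E. apply N2. 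
      replace (a - c * tau)%C with ((a - c * tau) * (a - c * tau) * / (a - c * tau))%C
        by (field; exact N2).
      rewrite E. ring.
    + unfold m, n. rewrite Hg1, Rmult_1_l, exp_ln, <- Eal by exact Ha1.
      unfold al, be. field. exact N2.
    + unfold m, n. rewrite Hg1, Rmult_1_l, exp_ln, <- Eal by exact Ha1.
      rewrite (fixed_eq_b _ _ _ _ _ Hfix). unfold al, be. field. exact N2.
    + field. exact N2.
    + rewrite (fixed_eq_b _ _ _ _ _ Hfix). field. exact N2.
Qed.

(** * Fixed points symmetric in the unit circle *)

Lemma linear_conj_group (p q r s : C) (m : R -> C) :
  (p * s - q * r)%C <> 0 ->
  (forall t, m t <> 0) ->
  (forall t u, m (t + u) = (m t * m u)%C) ->
  (forall eps : posreal, locally 0 (fun h => Cmod (m h - 1) < eps)) ->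
  mobius_group (affine_conj p q r s m (fun _ => RtoC 0)).
Proof.
  intros. apply affine_conj_group; auto.
  - intros t u. ring.
  - intros eps. apply filter_forall. intros h. rewrite Cmod_0. apply eps.
Qed.

(** The fixed points z and 1 / conj z are exchanged by reflection, so the disc
    automorphism sending them to 0 and infinity linearizes the map.  It becomes
    multiplication by l with |l| <= 1, embedded in the flow l^t. *)
Lemma symmetric_fixed_points_embed (a b c d z : C) (f : C -> C) :
  lf_self_map_coeffs a b c d f -> unit_disc z -> fixed_eq a b c d z ->
  (c + Cconj z * (d - a + c * z))%C = 0 ->
  embeds_in_mobius_group a b c d.
Proof.
  intros Hf Hz Hfix Hsym.
  pose proof (lf_coeffs_det _ _ _ _ _ Hf) as Hdet.
  destruct (fixed_factors_neq_0 _ _ _ _ _ Hdet Hfix) as [N1 N2].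
  pose proof (interior_fixed_bound _ _ _ _ _ _ Hf Hz Hfix) as HB.
  rewrite Hsym, Cmod_0, Rplus_0_r in HB.
  assert (HN1 := proj1 (Cmod_gt_0 _) N1). assert (HN2 := proj1 (Cmod_gt_0 _) N2).
  set (l := ((a - c * z) / (c * z + d))%C).
  assert (Hl : l <> 0) by (now apply Cdiv_neq_0).
  assert (Hl1 : 0 < Cmod l <= 1).
  { unfold l. rewrite Cmod_div by exact N1. split; [now apply Rdiv_lt_0_compat|].
    apply Rle_div_l; lra. }
  destruct (C_one_parameter_group l Hl) as (m & Hm & Hm1 & Hmod & Hmc).
  assert (Hm0 : forall t, m t <> 0).
  { intros t. apply Cmod_gt_0. rewrite Hmod. apply exp_pos. }
  assert (Hz' : unit_disc (- z)%C) by (unfold unit_disc; rewrite Cmod_opp; exact Hz).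
  pose proof (Cconj_mult_sqr z) as Hzz.
  assert (HS : (1 * 1 - - z * - Cconj z)%C <> 0).
  { replace (1 * 1 - - z * - Cconj z)%C with (1 - Cconj z * z)%C by ring.
    rewrite Hzz, <- RtoC_minus. intros E. apply RtoC_inj in E.
    unfold unit_disc in Hz. pose proof (Cmod_ge_0 z). nra. }
  exists (affine_conj 1 (- z)%C (- Cconj z)%C 1 m (fun _ => RtoC 0)). split; [|split].
  - apply linear_conj_group; auto.
  - intros t Ht v Hv. unfold affine_conj.
    destruct (disc_automorphism (- z) v Hz' Hv) as [Nv Hw].
    rewrite Copp_conj in Nv, Hw.
    rewrite mobius_Fin by exact Nv.
    replace (1 * v + - z)%C with (v + - z)%C by ring.
    set (w := ((v + - z) / (- Cconj z * v + 1))%C) in *.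
    rewrite mobius_Fin.
    2:{ replace (0 * w + 1)%C with (RtoC 1) by ring. exact C1_nz. }
    replace ((m t * w + 0) / (0 * w + 1))%C with (m t * w)%C.
    2:{ replace (0 * w + 1)%C with (RtoC 1) by ring. field. }
    assert (Hmw : unit_disc (m t * w)%C).
    { unfold unit_disc in *. rewrite Cmod_mult.
      assert (Cmod (m t) <= 1).
      { rewrite Hmod, <- exp_0.
        assert (Hln : ln (Cmod l) <= 0).
        { rewrite <- ln_1. destruct (proj2 Hl1) as [Hlt|Heq].
          - left. apply ln_increasing; lra.
          - right. now rewrite Heq. }
        assert (Hneg : t * ln (Cmod l) <= 0) by nra.
        destruct Hneg as [Hneg|Heq]; [left; now apply exp_increasing|right; now rewrite Heq]. }
      pose proof (Cmod_ge_0 w). pose proof (Cmod_ge_0 (m t)). nra. }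
    destruct (disc_automorphism z _ Hz Hmw) as [Nw Hd].
    replace (- - z)%C with z by ring. replace (- - Cconj z)%C with (Cconj z) by ring.
    rewrite mobius_Fin by exact Nw. eexists. split; [exact Hd|].
    do 2 f_equal. ring.
  - intros v.
    assert (Ec : c = (- (Cconj z * (d - a + c * z)))%C).
    { replace c with (c + Cconj z * (d - a + c * z) - Cconj z * (d - a + c * z))%C at 1
        by ring. rewrite Hsym. ring. }
    pose proof (fixed_eq_b _ _ _ _ _ Hfix) as Eb.
    apply (affine_conj_intertwine _ _ _ _ (/ (c * z + d))%C); auto.
    + intros E. apply C1_nz.
      replace (RtoC 1) with ((c * z + d) * / (c * z + d))%C by (field; exact N1).
      rewrite E. ring.
    + rewrite Hm1. unfold l. field. exact N1.
    + rewrite Hm1, Eb. unfold l. field. exact N1.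
    + replace (- Cconj z * a + 1 * c)%C with (- Cconj z * (c * z + d))%C.
      * field. exact N1.
      * rewrite Ec at 2. ring.
    + replace (- Cconj z * b + 1 * d)%C with (c * z + d)%C.
      * field. exact N1.
      * rewrite Eb. rewrite Ec at 1. ring.
Qed.

(** * An attracting fixed point *)

(** Writing t as a difference x - y of nonnegative numbers, mu x / mu y depends
    only on t; positive and negative parts provide one choice. *)
Lemma multiplicative_extension (mu : R -> C) :
  (forall t, 0 <= t -> mu t <> 0) ->
  (forall t u, 0 <= t -> 0 <= u -> mu (t + u) = (mu t * mu u)%C) ->
  (forall eps : posreal, at_right 0 (fun h => Cmod (mu h - 1) < eps)) ->
  exists m : R -> C,
    (forall t, 0 <= t -> m t = mu t) /\ (forall t, m t <> 0) /\
    (forall t u, m (t + u) = (m t * m u)%C) /\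
    (forall eps : posreal, locally 0 (fun h => Cmod (m h - 1) < eps)).
Proof.
  intros Hnz Hmul Hcont.
  assert (Hmu0 : mu 0 = 1).
  { assert (E : (mu 0 * (mu 0 - 1))%C = 0).
    { replace (mu 0 * (mu 0 - 1))%C with (mu 0 * mu 0 - mu 0)%C by ring.
      rewrite <- Hmul by lra. rewrite Rplus_0_r. ring. }
    destruct (Cmult_integral _ _ E) as [E'|E'].
    - exfalso. apply (Hnz 0); [lra|exact E'].
    - replace (mu 0) with (mu 0 - 1 + 1)%C by ring. rewrite E'. ring. }
  set (m := fun t => (mu (Rmax t 0) / mu (Rmax (- t) 0))%C).
  assert (Hp : forall t, 0 <= Rmax t 0) by (intros t; apply Rmax_r).
  assert (Hd : forall t, Rmax t 0 - Rmax (- t) 0 = t).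
  { intros t. unfold Rmax. destruct (Rle_dec t 0), (Rle_dec (- t) 0); lra. }
  assert (Hdiff : forall x y, 0 <= x -> 0 <= y -> m (x - y) = (mu x / mu y)%C).
  { intros x y Hx Hy. unfold m. set (t := x - y).
    assert (E : (mu (Rmax t 0) * mu y)%C = (mu x * mu (Rmax (- t) 0))%C).
    { rewrite <- !Hmul by auto. f_equal. pose proof (Hd t). unfold t in *. lra. }
    replace (mu (Rmax t 0)) with (mu (Rmax t 0) * mu y / mu y)%C by (field; auto).
    rewrite E. field. auto. }
  assert (Hpos : forall t, 0 <= t -> m t = mu t).
  { intros t Ht. replace t with (t - 0) at 1 by ring. rewrite Hdiff by lra.
    rewrite Hmu0. field. }
  exists m. split; [exact Hpos|]. split; [|split].
  - intros t. unfold m. apply Cdiv_neq_0; auto.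
  - intros t u.
    replace (t + u) with ((Rmax t 0 + Rmax u 0) - (Rmax (- t) 0 + Rmax (- u) 0)).
    2:{ pose proof (Hd t). pose proof (Hd u). lra. }
    rewrite Hdiff, !Hmul by auto using Rplus_le_le_0_compat.
    unfold m. field. auto.
  - intros eps.
    (* for h < 0 the value is 1 / mu (- h), and |mu (- h)| >= 1 / 2 costs a factor 2 *)
    assert (He : 0 < Rmin (/ 2) (eps / 2)).
    { apply Rmin_pos; [lra|]. destruct eps; simpl; lra. }
    destruct (Hcont (mkposreal _ He)) as [delta H].
    exists delta. intros h Hh. change R in h. change (Rabs (h - 0) < delta) in Hh. rewrite Rminus_0_r in Hh.
    assert (H' : forall k, 0 < k -> k < delta ->
              Cmod (mu k - 1) < / 2 /\ Cmod (mu k - 1) < eps / 2).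
    { intros k Hk Hkd. assert (Hb : Cmod (mu k - 1) < Rmin (/ 2) (eps / 2)).
      { apply (H k); [|exact Hk]. change (Rabs (k - 0) < delta).
        rewrite Rminus_0_r, Rabs_pos_eq; lra. }
      pose proof (Rmin_l (/ 2) (eps / 2)). pose proof (Rmin_r (/ 2) (eps / 2)). lra. }
    pose proof (cond_pos eps) as Heps.
    destruct (Rtotal_order h 0) as [Hneg|[->|Hps]].
    + replace h with (0 - - h) by ring. rewrite Hdiff, Hmu0 by lra.
      rewrite Rabs_left in Hh by exact Hneg.
      destruct (H' (- h)) as [H1 H2]; [lra|exact Hh|].
      assert (Hn := Hnz (- h) ltac:(lra)).
      set (x := mu (- h)) in *.
      replace (1 / x - 1)%C with (- (x - 1) / x)%C by (field; exact Hn).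
      rewrite Cmod_div, Cmod_opp by exact Hn.
      pose proof (Cmod_plus_ge 1 (x - 1)) as Hlow.
      replace (1 + (x - 1))%C with x in Hlow by ring.
      rewrite Cmod_1 in Hlow. apply Rlt_div_l; nra.
    + rewrite Hpos, Hmu0 by lra. replace (1 - 1)%C with (RtoC 0) by ring.
      rewrite Cmod_0. exact Heps.
    + rewrite Hpos by lra. rewrite Rabs_pos_eq in Hh by lra.
      destruct (H' h Hps Hh). lra.
Qed.

Lemma compact_singleton (z : C) : @compact_set C_UniformSpace (fun w => w = z).
Proof.
  intros I U _ Hcov. destruct (Hcov z eq_refl) as [i Hi].
  exists (i :: nil). intros x ->. exists i. split; [now left|exact Hi].
Qed.

Lemma small_power (l : C) (k : R) (eps : posreal) :
  Cmod l < 1 -> 0 <= k -> exists n, Cmod (l ^ n) * k < eps.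
Proof.
  intros Hl Hk. pose proof (Cmod_ge_0 l).
  assert (He : 0 < eps / (k + 1)) by (apply Rdiv_lt_0_compat; [apply eps|lra]).
  destruct (pow_lt_1_zero (Cmod l)) with (y := eps / (k + 1)) as [n Hn];
    [rewrite Rabs_pos_eq; lra|exact He|].
  exists n. specialize (Hn n (le_n n)).
  rewrite Rabs_pos_eq in Hn by (apply pow_le; lra).
  apply Rlt_div_r in Hn; [|lra]. rewrite Cmod_pow.
  assert (0 <= Cmod l ^ n) by (apply pow_le; lra). nra.
Qed.

(** This is where a mere holomorphic self-map g is forced to be linear fractional.
    Both sigma (g z) and sigma z get multiplied by l when z is replaced by f z, so
    sigma (g z) / sigma z is constant along the orbit of z.  For z <> z0 the orbit
    converges to z0, where the quotient tends to the derivative mu of g at z0,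
    because g fixes z0.  The linearizing coordinate sigma enters through its inverse relation
    z - z0 = sigma z (c z + e), which avoids division. *)
Lemma commuting_map_is_linear (f g sigma : C -> C) (l z0 c e : C) :
  self_map_disc f -> self_map_disc g ->
  (forall z, unit_disc z -> f (g z) = g (f z)) ->
  (forall z, unit_disc z -> sigma (f z) = (l * sigma z)%C) ->
  (forall z, unit_disc z -> (z - z0)%C = (sigma z * (c * z + e))%C) ->
  l <> 0 -> Cmod l < 1 -> (c * z0 + e)%C <> 0 -> g z0 = z0 ->
  @ex_derive C_AbsRing C_NormedModule g z0 ->
  exists mu, forall z, unit_disc z -> sigma (g z) = (mu * sigma z)%C.
Proof.
  intros Hf Hg Hcomm Hsig Hinv Hl Hl1 Hz0 Hgz0 Hder.
  apply ex_derive_C_iff in Hder. destruct Hder as [mu Hmu].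
  exists mu. intros z Hz.
  set (u := fun n => Nat.iter n f z).
  assert (Hu : forall n, unit_disc (u n)).
  { induction n as [|n IH]; [exact Hz|]. now apply Hf. }
  assert (Hsu : forall n, sigma (u n) = (l ^ n * sigma z)%C).
  { induction n as [|n IH]; [simpl; ring|].
    change (u (S n)) with (f (u n)). rewrite Hsig, IH by auto. simpl. ring. }
  assert (Hsg : forall n, sigma (g (u n)) = (l ^ n * sigma (g z))%C).
  { assert (Hgu : forall n, g (u n) = Nat.iter n f (g z)).
    { induction n as [|n IH]; [reflexivity|].
      change (u (S n)) with (f (u n)). rewrite <- Hcomm, IH by auto. reflexivity. }
    induction n as [|n IH]; [simpl; ring|].
    change (u (S n)) with (f (u n)). rewrite <- Hcomm, Hsig, IH by auto. simpl. ring. }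
  set (s := sigma z) in *. set (r := sigma (g z)) in *.
  set (K := Cmod c + Cmod e).
  pose proof (Cmod_ge_0 c) as Hc. pose proof (Cmod_ge_0 e) as He.
  assert (HK : forall w, unit_disc w -> Cmod (c * w + e) <= K).
  { intros w Hw. unfold unit_disc in Hw. eapply Rle_trans; [apply Cmod_triangle|].
    rewrite Cmod_mult. unfold K. nra. }
  assert (Hln : forall n, 0 < Cmod (l ^ n)).
  { intros n. rewrite Cmod_pow. apply pow_lt. now apply Cmod_gt_0. }
  set (D := Cmod (c * z0 + e)). assert (HD : 0 < D) by now apply Cmod_gt_0.
  pose proof (Cmod_ge_0 s) as Hs0. pose proof (Cmod_ge_0 r) as Hr0.
  pose proof (Cmod_ge_0 mu) as Hmu0.
  assert (Hsmall : forall eps : posreal,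
    Cmod (r - mu * s) * D <= eps * (Cmod s * K + Cmod c + 1)).
  { intros eps. destruct (Hmu eps) as [delta Hdel].
    (* after n steps each error term is at most |l|^n times a summand of k *)
    set (k := Cmod s * K + Cmod r * (Cmod r * K) + Cmod mu * Cmod s * (Cmod s * K)).
    assert (HK0 : 0 <= K) by (unfold K; lra).
    assert (Hsk : 0 <= Cmod s * K) by nra. assert (Hrk : 0 <= Cmod r * K) by nra.
    assert (H1 : 0 <= Cmod r * (Cmod r * K)) by nra.
    assert (H2 : 0 <= Cmod mu * Cmod s) by nra.
    assert (H3 : 0 <= Cmod mu * Cmod s * (Cmod s * K)) by nra.
    assert (Hk : 0 <= k) by (unfold k; lra).
    assert (Hmin : 0 < Rmin delta eps) by (apply Rmin_pos; [apply delta|apply eps]).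
    destruct (small_power l k (mkposreal _ Hmin) Hl1 Hk) as [n Hn]. simpl in Hn.
    pose proof (Rmin_l delta eps). pose proof (Rmin_r delta eps).
    pose proof (Hln n) as Hq. set (q := Cmod (l ^ n)) in *.
    assert (Bu : Cmod (u n - z0) <= q * (Cmod s * K)).
    { rewrite Hinv, Hsu by auto. rewrite !Cmod_mult. fold q.
      rewrite Rmult_assoc. apply Rmult_le_compat_l; [lra|].
      apply Rmult_le_compat_l; auto. }
    assert (Bv : Cmod (g (u n) - z0) <= q * (Cmod r * K)).
    { rewrite Hinv, Hsg by auto. rewrite !Cmod_mult. fold q.
      rewrite Rmult_assoc. apply Rmult_le_compat_l; [lra|].
      apply Rmult_le_compat_l; auto. }
    assert (Bd : Cmod (u n - z0) < delta).
    { eapply Rle_lt_trans; [exact Bu|]. unfold k in Hn. nra. }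
    specialize (Hdel (u n) Bd). rewrite Hgz0 in Hdel.
    assert (Hmain : Cmod (r * (c * g (u n) + e) - mu * (s * (c * u n + e)))
                    <= eps * (Cmod s * K)).
    { apply Rmult_le_reg_l with q; [exact Hq|]. unfold q at 1. rewrite <- Cmod_mult.
      replace (l ^ n * (r * (c * g (u n) + e) - mu * (s * (c * u n + e))))%C
        with (g (u n) - z0 - (u n - z0) * mu)%C.
      - eapply Rle_trans; [exact Hdel|]. pose proof (cond_pos eps). nra.
      - rewrite (Hinv (g (u n))), (Hinv (u n)), Hsu, Hsg by auto. ring. }
    unfold D. rewrite <- Cmod_mult.
    replace ((r - mu * s) * (c * z0 + e))%C
      with (r * (c * g (u n) + e) - mu * (s * (c * u n + e))
            - c * (r * (g (u n) - z0) - mu * s * (u n - z0)))%C by ring.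
    eapply Rle_trans; [apply Cmod_minus_triangle|]. rewrite (Cmod_mult c).
    assert (Herr : Cmod (r * (g (u n) - z0) - mu * s * (u n - z0)) <= eps).
    { eapply Rle_trans; [apply Cmod_minus_triangle|]. rewrite !Cmod_mult.
      assert (Cmod r * Cmod (g (u n) - z0) <= Cmod r * (q * (Cmod r * K)))
        by (apply Rmult_le_compat_l; assumption).
      assert (Cmod mu * Cmod s * Cmod (u n - z0) <= Cmod mu * Cmod s * (q * (Cmod s * K)))
        by (apply Rmult_le_compat_l; assumption).
      unfold k in Hn. nra. }
    pose proof (cond_pos eps). nra. }
  assert (Hz0' : (r - mu * s)%C = 0).
  { apply Cmod_eq_0. apply Rle_antisym; [|apply Cmod_ge_0].
    apply Rnot_lt_le. intros Hlt.
    set (B := Cmod s * K + Cmod c + 1).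
    assert (HB : 0 < B).
    { unfold B. assert (0 <= Cmod s * K) by (apply Rmult_le_pos; unfold K; lra). lra. }
    assert (Hp : 0 < Cmod (r - mu * s) * D / (2 * B)).
    { apply Rdiv_lt_0_compat; [now apply Rmult_lt_0_compat|lra]. }
    specialize (Hsmall (mkposreal _ Hp)). simpl in Hsmall. fold B in Hsmall.
    replace (Cmod (r - mu * s) * D / (2 * B) * B) with (Cmod (r - mu * s) * D / 2) in Hsmall
      by (field; lra).
    assert (0 < Cmod (r - mu * s) * D) by now apply Rmult_lt_0_compat. lra. }
  replace r with (r - mu * s + mu * s)%C by ring. rewrite Hz0'. ring.
Qed.

Lemma fixed_eq_factor (a b c d z0 z : C) :
  fixed_eq a b c d z0 ->
  (c * z * z + (d - a) * z - b)%C = ((z - z0) * (c * z + (d - a + c * z0)))%C.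
Proof. intros H. rewrite (fixed_eq_b _ _ _ _ _ H). ring. Qed.

Lemma lf_fixed_iff (a b c d z : C) :
  (c * z + d)%C <> 0 ->
  ((a * z + b) / (c * z + d))%C = z <-> fixed_eq a b c d z.
Proof.
  intros Hn. unfold fixed_eq. split; intros H.
  - assert (E : (a * z + b)%C = (z * (c * z + d))%C).
    { rewrite <- H at 2. field. exact Hn. }
    replace (c * z * z + (d - a) * z - b)%C with (z * (c * z + d) - (a * z + b))%C by ring.
    rewrite <- E. ring.
  - replace (a * z + b)%C with (z * (c * z + d) - (c * z * z + (d - a) * z - b))%C by ring.
    rewrite H. field. exact Hn.
Qed.

(** The coordinate (z - z0) / (c z + e) sends the fixed points z0 and - e / c, if
    distinct, to 0 and infinity, hence turns the map into multiplication by its multiplier. *)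
Lemma lf_linearized (a b c d z0 z : C) :
  let e := (d - a + c * z0)%C in
  let w := ((a * z + b) / (c * z + d))%C in
  fixed_eq a b c d z0 ->
  (c * z + d)%C <> 0 -> (c * z0 + d)%C <> 0 ->
  (c * z + e)%C <> 0 ->
  ((w - z0) / (c * w + e))%C
  = ((a - c * z0) / (c * z0 + d) * ((z - z0) / (c * z + e)))%C.
Proof.
  intros e w Hfix N N0 Ne.
  assert (E1 : (w - z0)%C = ((a - c * z0) * (z - z0) / (c * z + d))%C).
  { unfold w. rewrite (fixed_eq_b _ _ _ _ _ Hfix). field. exact N. }
  assert (E2 : (c * w + e)%C = ((c * z0 + d) * (c * z + e) / (c * z + d))%C).
  { unfold w, e. rewrite (fixed_eq_b _ _ _ _ _ Hfix). field. exact N. }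
  rewrite E1, E2. field. repeat split; assumption.
Qed.

(** A pole of the linearizing coordinate would be an interior fixed point with the
    inverse multiplier, of modulus greater than 1. *)
Lemma attracting_pole_outside_disc (a b c d z0 : C) (f : C -> C) :
  lf_self_map_coeffs a b c d f -> fixed_eq a b c d z0 ->
  Cmod (a - c * z0) < Cmod (c * z0 + d) ->
  forall z, unit_disc z -> (c * z + (d - a + c * z0))%C <> 0.
Proof.
  intros Hf Hfix Hlt z Hz E.
  assert (Hfix' : fixed_eq a b c d z).
  { unfold fixed_eq. rewrite (fixed_eq_factor _ _ _ _ _ _ Hfix), E. ring. }
  pose proof (interior_fixed_bound _ _ _ _ _ _ Hf Hz Hfix') as HB.
  pose proof (Cmod_ge_0 (c + Cconj z * (d - a + c * z))).
  replace (a - c * z)%C with (c * z0 + d - (c * z + (d - a + c * z0)))%C in HB by ring.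
  replace (c * z + d)%C with (a - c * z0 + (c * z + (d - a + c * z0)))%C in HB by ring.
  rewrite E in HB. replace (c * z0 + d - 0)%C with (c * z0 + d)%C in HB by ring.
  replace (a - c * z0 + 0)%C with (a - c * z0)%C in HB by ring. lra.
Qed.

(** Every psi t commutes with psi 1, hence fixes its unique fixed point z0 in the
    disc, and is linear in the coordinate that linearizes psi 1. *)
Lemma attracting_multipliers (a b c d z0 : C) (f : C -> C) (psi : R -> C -> C) :
  let e := (d - a + c * z0)%C in
  let sigma := fun z => ((z - z0) / (c * z + e))%C in
  lf_self_map_coeffs a b c d f -> semigroup_in_disc psi -> eq_on_disc (psi 1) f ->
  unit_disc z0 -> fixed_eq a b c d z0 ->
  Cmod (a - c * z0) < Cmod (c * z0 + d) ->
  forall t, 0 <= t ->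
  exists mu, forall z, unit_disc z -> sigma (psi t z) = (mu * sigma z)%C.
Proof.
  intros e sigma Hf (Hself & _ & Hadd & _) H1 Hz0 Hfix Hlt t Ht.
  pose proof (lf_coeffs_det _ _ _ _ _ Hf) as Hdet.
  destruct (fixed_factors_neq_0 _ _ _ _ _ Hdet Hfix) as [N1 N2].
  pose proof (attracting_pole_outside_disc _ _ _ _ _ _ Hf Hfix Hlt) as Hpole. fold e in Hpole.
  assert (Hfz : forall z, unit_disc z ->
            (c * z + d)%C <> 0 /\ psi 1 z = ((a * z + b) / (c * z + d))%C).
  { intros z Hz. split.
    - apply disc_denominator_neq_0; [exact (proj1 Hf)|]. unfold unit_disc in Hz. lra.
    - rewrite (H1 z Hz). now apply Hf. }
  assert (Hcomm : forall z, unit_disc z -> psi 1 (psi t z) = psi t (psi 1 z)).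
  { intros z Hz. rewrite <- (Hadd 1 t), <- (Hadd t 1) by (assumption || lra).
    now rewrite Rplus_comm. }
  apply (commuting_map_is_linear (psi 1) (psi t) sigma
           ((a - c * z0) / (c * z0 + d))%C z0 c e).
  - apply Hself. lra.
  - now apply Hself.
  - exact Hcomm.
  - intros z Hz. destruct (Hfz z Hz) as [N E]. unfold sigma. rewrite E.
    apply lf_linearized; auto.
  - intros z Hz. unfold sigma. field. now apply Hpole.
  - now apply Cdiv_neq_0.
  - rewrite Cmod_div by exact N1. apply Rlt_div_l; [now apply Cmod_gt_0|lra].
  - now apply Hpole.
  - assert (Hw : unit_disc (psi t z0)) by now apply Hself.
    destruct (Hfz _ Hz0) as [N E]. destruct (Hfz _ Hw) as [N' E'].
    assert (Hw' : psi 1 (psi t z0) = psi t z0).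
    { rewrite Hcomm by exact Hz0. f_equal. rewrite E. now apply lf_fixed_iff. }
    rewrite E' in Hw'. apply lf_fixed_iff in Hw'; [|exact N'].
    unfold fixed_eq in Hw'. rewrite (fixed_eq_factor _ _ _ _ _ _ Hfix) in Hw'.
    destruct (Cmult_integral _ _ Hw') as [E0|E0].
    + replace (psi t z0) with (psi t z0 - z0 + z0)%C by ring. rewrite E0. ring.
    + now destruct (Hpole _ Hw).
  - now apply Hself.
Qed.

Lemma linearizer_continuous (z0 c e z : C) (eps : posreal) :
  (c * z + e)%C <> 0 ->
  exists delta : posreal, forall w, Cmod (w - z) < delta ->
    Cmod ((w - z0) / (c * w + e) - (z - z0) / (c * z + e)) < eps.
Proof.
  intros N. assert (HP := proj1 (Cmod_gt_0 _) N).
  set (P := Cmod (c * z + e)) in *. set (D := Cmod (e + c * z0)).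
  pose proof (Cmod_ge_0 c) as Hc. pose proof (Cmod_ge_0 (e + c * z0)) as HD. fold D in HD.
  pose proof (cond_pos eps) as He.
  assert (H1 : 0 < P / (2 * (Cmod c + 1))) by (apply Rdiv_lt_0_compat; lra).
  assert (H2 : 0 < eps * (P * P) / (2 * (D + 1))).
  { apply Rdiv_lt_0_compat; [|lra]. apply Rmult_lt_0_compat; nra. }
  exists (mkposreal _ (Rmin_pos _ _ H1 H2)). simpl. intros w Hw.
  assert (Hw1 := Rlt_le_trans _ _ _ Hw (Rmin_l _ _)).
  assert (Hw2 := Rlt_le_trans _ _ _ Hw (Rmin_r _ _)).
  apply Rlt_div_r in Hw1; [|lra]. apply Rlt_div_r in Hw2; [|lra].
  pose proof (Cmod_ge_0 (w - z)) as Hx.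
  assert (Hden : P / 2 < Cmod (c * w + e)).
  { pose proof (Cmod_plus_ge (c * z + e) (c * (w - z))) as H.
    replace (c * z + e + c * (w - z))%C with (c * w + e)%C in H by ring.
    rewrite Cmod_mult in H. fold P in H. nra. }
  assert (Nw : (c * w + e)%C <> 0) by (apply Cmod_gt_0; lra).
  replace ((w - z0) / (c * w + e) - (z - z0) / (c * z + e))%C
    with ((e + c * z0) * (w - z) / ((c * w + e) * (c * z + e)))%C
    by (field; now split).
  rewrite Cmod_div by (apply Cmod_gt_0; rewrite Cmod_mult; fold P; nra).
  rewrite !Cmod_mult. fold P D.
  apply Rlt_div_l; [nra|].
  assert (eps * (P / 2 * P) < eps * (Cmod (c * w + e) * P)).
  { apply Rmult_lt_compat_l; [exact He|]. apply Rmult_lt_compat_r; assumption. }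
  nra.
Qed.

(** The multipliers mu t of the given semigroup are multiplicative and tend to 1
    at 0.  They do not vanish: mu n = l^n factors through mu t for every integer
    n > t.  Their extension to the real line defines the group, which coincides with
    the semigroup on the disc for t >= 0, so it maps the disc into itself. *)
Lemma attracting_semigroup_embeds (a b c d z0 : C) (f : C -> C) (psi : R -> C -> C) :
  lf_self_map_coeffs a b c d f -> semigroup_in_disc psi -> eq_on_disc (psi 1) f ->
  unit_disc z0 -> fixed_eq a b c d z0 ->
  Cmod (a - c * z0) < Cmod (c * z0 + d) ->
  embeds_in_mobius_group a b c d.
Proof.
  intros Hf Hpsi H1 Hz0 Hfix Hlt.
  pose proof (attracting_multipliers _ _ _ _ _ _ _ Hf Hpsi H1 Hz0 Hfix Hlt) as Hlin.
  pose proof (attracting_pole_outside_disc _ _ _ _ _ _ Hf Hfix Hlt) as Hpole.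
  pose proof (lf_coeffs_det _ _ _ _ _ Hf) as Hdet.
  destruct (fixed_factors_neq_0 _ _ _ _ _ Hdet Hfix) as [N1 N2].
  set (e := (d - a + c * z0)%C) in *.
  set (sigma := fun z => ((z - z0) / (c * z + e))%C) in *.
  destruct Hpsi as (Hself & Hid & Hadd & Hcont).
  set (l := ((a - c * z0) / (c * z0 + d))%C).
  assert (Hl : l <> 0) by now apply Cdiv_neq_0.
  (* the multipliers are read off at a point p other than z0 *)
  assert (Hp : exists p, unit_disc p /\ (p - z0)%C <> 0).
  { destruct (Ceq_dec z0 0) as [->|Hn].
    - exists (RtoC (/ 2)). split.
      + unfold unit_disc. rewrite Cmod_RtoC_pos; lra.
      + rewrite <- RtoC_minus. intros E. apply RtoC_inj in E. lra.
    - exists (RtoC 0). split; [unfold unit_disc; rewrite Cmod_0; lra|].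
      intros E. apply Hn. replace z0 with (0 - (0 - z0))%C by ring. rewrite E. ring. }
  destruct Hp as (p & Hp & Np).
  assert (Hsp : sigma p <> 0) by (apply Cdiv_neq_0; auto).
  set (mu := fun t => (sigma (psi t p) / sigma p)%C).
  assert (Hmu : forall t z, 0 <= t -> unit_disc z -> sigma (psi t z) = (mu t * sigma z)%C).
  { intros t z Ht Hz. destruct (Hlin t Ht) as [k Hk]. unfold mu.
    rewrite (Hk z Hz), (Hk p Hp). field. exact Hsp. }
  assert (Hmul : forall t u, 0 <= t -> 0 <= u -> mu (t + u) = (mu t * mu u)%C).
  { intros t u Ht Hu. unfold mu at 1.
    rewrite (Hadd t u Ht Hu p Hp), Hmu, Hmu by (auto; now apply Hself). field. exact Hsp. }
  assert (Hmu1 : mu 1 = l).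
  { unfold mu. rewrite (H1 p Hp), (proj1 (proj2 Hf) p Hp).
    unfold sigma at 1. unfold e. rewrite lf_linearized; auto.
    - fold e. change ((p - z0) / (c * p + e))%C with (sigma p). fold l. field. exact Hsp.
    - apply disc_denominator_neq_0; [exact (proj1 Hf)|]. unfold unit_disc in Hp. lra. }
  assert (HmuN : forall n, mu (INR n) <> 0).
  { induction n as [|n IH].
    - unfold mu. simpl INR. rewrite (Hid p Hp). now apply Cdiv_neq_0.
    - rewrite S_INR, Hmul, Hmu1 by (lra || apply pos_INR).
      intros E. destruct (Cmult_integral _ _ E); contradiction. }
  assert (Hmunz : forall t, 0 <= t -> mu t <> 0).
  { intros t Ht E. destruct (INR_unbounded t) as [n Hn].
    apply (HmuN n). replace (INR n) with (INR n - t + t) by ring.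
    rewrite Hmul, E by lra. ring. }
  assert (Hmuc : forall eps : posreal, at_right 0 (fun h => Cmod (mu h - 1) < eps)).
  { intros eps. assert (Hsp' := proj1 (Cmod_gt_0 _) Hsp).
    assert (He : 0 < eps * Cmod (sigma p)) by (apply Rmult_lt_0_compat; [apply eps|exact Hsp']).
    destruct (linearizer_continuous z0 c e p (mkposreal _ He) (Hpole p Hp)) as [delta Hd].
    assert (Hsing : forall z, z = p -> unit_disc z) by (intros z ->; exact Hp).
    apply filter_imp with (2 := Hcont _ (compact_singleton p) Hsing delta).
    intros h Hh. specialize (Hd _ (Hh p eq_refl)). simpl in Hd.
    replace (mu h - 1)%C with ((sigma (psi h p) - sigma p) / sigma p)%C
      by (unfold mu; field; exact Hsp).
    rewrite Cmod_div by exact Hsp. apply Rlt_div_l; [exact Hsp'|exact Hd]. }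
  destruct (multiplicative_extension mu Hmunz Hmul Hmuc) as (m & Hm & Hmnz & Hmm & Hmc).
  assert (HS : (1 * e - - z0 * c)%C <> 0).
  { intros E. apply (Rlt_irrefl (Cmod (c * z0 + d))).
    replace (c * z0 + d)%C with (a - c * z0 + (1 * e - - z0 * c))%C at 1
      by (unfold e; ring).
    rewrite E. replace (a - c * z0 + 0)%C with (a - c * z0)%C by ring. exact Hlt. }
  assert (Hsig : forall z, unit_disc z -> mobius 1 (- z0) c e (Fin z) = Fin (sigma z)).
  { intros z Hz. rewrite mobius_Fin by auto. unfold sigma. do 2 f_equal. ring. }
  exists (affine_conj 1 (- z0)%C c e m (fun _ => RtoC 0)). split; [|split].
  - apply linear_conj_group; auto.
  - intros t Ht z Hz. assert (Hw : unit_disc (psi t z)) by now apply Hself.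
    exists (psi t z). split; [exact Hw|]. unfold affine_conj.
    rewrite Hsig by exact Hz. rewrite mobius_Fin.
    2:{ replace (0 * sigma z + 1)%C with (RtoC 1) by ring. exact C1_nz. }
    replace ((m t * sigma z + 0) / (0 * sigma z + 1))%C with (sigma (psi t z)).
    + rewrite <- Hsig by exact Hw. now apply mobius_adjugate.
    + rewrite Hmu, Hm by assumption.
      replace (0 * sigma z + 1)%C with (RtoC 1) by ring. field.
  - intros z. pose proof (fixed_eq_b _ _ _ _ _ Hfix) as Eb.
    assert (Hm1 : m 1 = l) by (rewrite Hm, Hmu1 by lra; reflexivity).
    apply (affine_conj_intertwine _ _ _ _ (/ (c * z0 + d))%C); auto.
    + intros E. apply C1_nz.
      replace (RtoC 1) with ((c * z0 + d) * / (c * z0 + d))%C by (field; exact N1).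
      rewrite E. ring.
    + rewrite Hm1. unfold l. field. exact N1.
    + rewrite Hm1, Eb. unfold l. field. exact N1.
    + unfold e. field. exact N1.
    + rewrite Eb. unfold e. field. exact N1.
Qed.

(** * The equivalence *)

Lemma semigroup_embeds_in_mobius_group (a b c d : C) (f : C -> C) (psi : R -> C -> C) :
  lf_self_map_coeffs a b c d f -> semigroup_in_disc psi -> eq_on_disc (psi 1) f ->
  embeds_in_mobius_group a b c d.
Proof.
  intros Hf Hpsi H1.
  destruct (fixed_point_in_closed_disc _ _ _ _ _ Hf) as (z & Hz & Hfix).
  destruct Hz as [Hz|Hz]; [|now apply (boundary_fixed_point_embeds _ _ _ _ z f)].
  destruct (Ceq_dec (c + Cconj z * (d - a + c * z)) 0) as [Hsym|Hn].
  - now apply (symmetric_fixed_points_embed _ _ _ _ z f).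
  - apply (attracting_semigroup_embeds a b c d z f psi); auto.
    pose proof (interior_fixed_bound _ _ _ _ _ _ Hf Hz Hfix).
    apply Cmod_gt_0 in Hn. lra.
Qed.

Theorem theorem3p3 (phi : C -> C) (a b c d : C)
    (Hphi : lf_self_map_coeffs a b c d phi) :
  ((exists psi : R -> C -> C,
      semigroup_in_disc psi /\ eq_on_disc (psi 1) phi)
   <->
   (exists psi : R -> C -> C,
      lf_semigroup_in_disc psi /\ eq_on_disc (psi 1) phi))
  /\
  ((exists psi : R -> C -> C,
      lf_semigroup_in_disc psi /\ eq_on_disc (psi 1) phi)
   <->
   (exists Phi : R -> sphere -> sphere,
      mobius_group Phi /\
      (forall t : R, 0 <= t -> maps_disc_into_disc (Phi t)) /\
      (forall p : sphere, Phi 1 p = mobius a b c d p))).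
Proof.
  assert (H31 : embeds_in_mobius_group a b c d ->
    exists psi, lf_semigroup_in_disc psi /\ eq_on_disc (psi 1) phi).
  { intros (Phi & HG & HD & HPhi1).
    exists (fun t => disc_trace (Phi t)).
    split; [now apply mobius_group_restricts|].
    intros z Hz. unfold disc_trace. rewrite HPhi1, mobius_Fin.
    - symmetry. now apply Hphi.
    - apply disc_denominator_neq_0; [exact (proj1 Hphi)|]. unfold unit_disc in Hz. lra. }
  split; split.
  - intros (psi & Hpsi & H1). apply H31.
    now apply (semigroup_embeds_in_mobius_group _ _ _ _ phi psi).
  - intros (psi & [Hpsi _] & H1). now exists psi.
  - intros (psi & [Hpsi _] & H1).
    now apply (semigroup_embeds_in_mobius_group _ _ _ _ phi psi).
  - exact H31.
Qed.
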